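(* Let $n=2\mathsf{r}$ with $\mathsf{r}\ge1$ and let $D=(2\varpi_{\mathsf r}-\varpi_0)[\infty]$ (no finite points). Write $T_D(z)$ in $\mathsf r\times\mathsf r$ block form and let $K$ be its lower-left block (rows $\mathsf r+1,\dots,2\mathsf r$, columns $1,\dots,\mathsf r$) and $\bar K$ its upper-right block (rows $1,\dots,\mathsf r$, columns $\mathsf r+1,\dots,2\mathsf r$). Then $K$ and $\bar K$ are independent of $z$ and $K\cdot\bar K=-I_{\mathsf r}$.
   Context: Let $\Lambda=\bigoplus_{j=1}^n\mathbb{Z}\epsilon_j$, $\alpha_i=\epsilon_i-\epsilon_{i+1}$, $\varpi_i=-\sum_{j=i+1}^n\epsilon_j$. Here $\mu=2\varpi_{\mathsf r}-\varpi_0=\sum_ia_i\alpha_i$ with $a_i=\min(i,2\mathsf r-i)$; $a_0=a_n=0$. $\mathcal{A}$: the $\mathbb{C}$-algebra generated by $p_{i,r},e^{\pm q_{i,r}},(p_{i,r}-p_{i,s}+m)^{-1}$ ($1\le i<n$, $1\le r\ne s\le a_i$, $m\in\mathbb{Z}$) with $[e^{\pm q_{i,r}},p_{j,s}]=\mp\delta_{ij}\delta_{rs}e^{\pm q_{i,r}}$, $p$'s commuting, $e^q$'s commuting, $e^{\pm q_{i,r}}e^{\mp q_{i,r}}=1$. $P_j(z)=\prod_{r=1}^{a_j}(z-p_{j,r})$, $P_{j,r}(z)=\prod_{s\ne r}(z-p_{j,s})$, $P_0=P_n=1$. $T_D(z)\in\mathcal{A}((z^{-1}))\otimes\mathrm{End}\,\mathbb{C}^n$: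 $T_D(z)_{\alpha\beta}=\sum_{i=1}^{\min(\alpha,\beta)}f^D_{\alpha i}(z)g^D_i(z)e^D_{i\beta}(z)$, where (expanded in $z^{-1}$) $g^D_i(z)=\frac{P_i(z)}{P_{i-1}(z-1)}$, $e^D_{ii}=f^D_{ii}=1$ and for $i<j$: $e^D_{ij}(z)=-\sum_{r_i,\dots,r_{j-1}}\frac{P_{i-1}(p_{i,r_i}-1)\prod_{k=i}^{j-2}P_{k,r_k}(p_{k+1,r_{k+1}}-1)}{(z-p_{i,r_i})\prod_{k=i}^{j-1}P_{k,r_k}(p_{k,r_k})}\, e^{\sum_{k=i}^{j-1}q_{k,r_k}}$, $f^D_{ji}(z)=\sum_{r_i,\dots,r_{j-1}}\frac{P_j(p_{j-1,r_{j-1}}+1)\prod_{k=i+1}^{j-1}P_{k,r_k}(p_{k-1,r_{k-1}}+1)}{(z-p_{i,r_i}-1)\prod_{k=i}^{j-1}P_{k,r_k}(p_{k,r_k})}\, e^{-\sum_{k=i}^{j-1}q_{k,r_k}}$ (sums over $1\le r_k\le a_k$). *)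

(* Defs.v *)
From HB Require Import structures.
From mathcomp Require Import all_boot all_order all_algebra.
Set Implicit Arguments. Unset Strict Implicit. Unset Printing Implicit Defensive.
Import Order.TTheory GRing.Theory Num.Theory.
Local Open Scope ring_scope.

(* Formal Laurent series in z^{-1} with coefficients in a (possibly
   non-commutative) ring A; z is central.  A series s stands for
      sum_{k >= 0} lco s k * z^(ldeg s - k).                            *)
Record lser (A : Type) := LSer { ldeg : int; lco : nat -> A }.

Section LaurentSeries.
Variable A : nzRingType.

Definition lcoef (s : lser A) (m : int) : A :=
  match (ldeg s - m)%R with Posz k => lco s k | Negz _ => 0 end.

Definition ladd (s t : lser A) : lser A :=
  let d := Num.max (ldeg s) (ldeg t) in
  LSer d (fun k => lcoef s (d - k%:Z) + lcoef t (d - k%:Z)).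

Definition lmul (s t : lser A) : lser A :=
  LSer (ldeg s + ldeg t)
       (fun k => \sum_(i < k.+1) lco s i * lco t (k - i)%N).

Definition lconst (c : A) : lser A := LSer 0 (fun k => if k == 0%N then c else 0).

(* 1/(z - x) expanded in z^{-1} :  sum_k x^k z^(-k-1) *)
Definition lgeom (x : A) : lser A := LSer (-1) (fun k => x ^+ k).

Definition llin (x : A) : lser A :=
  LSer 1 (fun k => if k == 0%N then 1 else if k == 1%N then - x else 0).

Definition lsum (l : seq (lser A)) : lser A := foldr ladd (lconst 0) l.
Definition lprod (l : seq (lser A)) : lser A := foldr lmul (lconst 1) l.
End LaurentSeries.

Definition acoef (r i : nat) : nat := minn i (2 * r - i).

Fixpoint tuples (a : nat -> nat) (i len : nat) : seq (seq nat) :=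
  match len with
  | 0 => [:: [::]]
  | len'.+1 => [seq x :: t | x <- iota 1 (a i), t <- tuples a i.+1 len']
  end.

(* Generators of the algebra A:
   gp i s = p_{i,s},  gq i s = e^{q_{i,s}},  gqi i s = e^{-q_{i,s}},
   ginv i s t m = (p_{i,s} - p_{i,t} + m)^{-1}.                         *)
Record gens (A : Type) := Gens {
  gp : nat -> nat -> A;
  gq : nat -> nat -> A;
  gqi : nat -> nat -> A;
  ginv : nat -> nat -> nat -> int -> A }.

Section Relations.
Variables (A : nzRingType) (r : nat) (G : gens A).
Let a := acoef r.
Let n := (2 * r)%N.
Let inr i s := [&& 0 < i, i < n, 0 < s & s <= a i]%N.

Definition rels : Prop :=
  [/\ (forall i s j t, inr i s -> inr j t ->
          gp G i s * gp G j t = gp G j t * gp G i s),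
      (forall i s j t, inr i s -> inr j t ->
          [/\ gq G i s * gq G j t = gq G j t * gq G i s,
              gq G i s * gqi G j t = gqi G j t * gq G i s &
              gqi G i s * gqi G j t = gqi G j t * gqi G i s]),
      (forall i s, inr i s ->
          gq G i s * gqi G i s = 1 /\ gqi G i s * gq G i s = 1),
      (forall i s j t, inr i s -> inr j t ->
          gq G i s * gp G j t - gp G j t * gq G i s
            = - ((i == j) && (s == t))%:R * gq G i s /\
          gqi G i s * gp G j t - gp G j t * gqi G i s
            = ((i == j) && (s == t))%:R * gqi G i s) &
      (forall i s t (m : int), inr i s -> inr i t -> s != t ->
          (gp G i s - gp G i t + m%:~R) * ginv G i s t m = 1 /\
          ginv G i s t m * (gp G i s - gp G i t + m%:~R) = 1)].
End Relations.

Section TD.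
Variables (A : nzRingType) (r : nat) (G : gens A).
Let a := acoef r.
Let p := gp G.

(* P_j(x) = prod_{s=1}^{a_j} (x - p_{j,s});   P_0 = P_n = 1 since a_0 = a_n = 0 *)
Definition Pev (j : nat) (x : A) : A := \prod_(s <- iota 1 (a j)) (x - p j s).
Definition Pev' (j t : nat) (x : A) : A :=
  \prod_(s <- iota 1 (a j) | s != t) (x - p j s).
(* P_{j,t}(p_{j,t})^{-1} = prod_{s <> t} (p_{j,t} - p_{j,s})^{-1} *)
Definition Pinv' (j t : nat) : A :=
  \prod_(s <- iota 1 (a j) | s != t) ginv G j t s 0.

(* g_i(z) = P_i(z) / P_{i-1}(z-1) *)
Definition gD (i : nat) : lser A :=
  lmul (lprod [seq llin (p i s) | s <- iota 1 (a i)])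
       (lprod [seq lgeom (p i.-1 s + 1) | s <- iota 1 (a i.-1)]).

(* r_k read from the tuple rs = [:: r_i; ...; r_(j-1)] *)
Definition rk (i : nat) (rs : seq nat) (k : nat) : nat := nth 0%N rs (k - i).

Definition eterm (i j : nat) (rs : seq nat) : lser A :=
  let R := rk i rs in
  let num := Pev i.-1 (p i (R i) - 1) *
             \prod_(k <- iota i (j.-1 - i)) Pev' k (R k) (p k.+1 (R k.+1) - 1) in
  let den := \prod_(k <- iota i (j - i)) Pinv' k (R k) in
  let E := \prod_(k <- iota i (j - i)) gq G k (R k) in
  lmul (lconst (- (num * den))) (lmul (lgeom (p i (R i))) (lconst E)).

Definition eD (i j : nat) : lser A :=
  if i == j then lconst 1
  else lsum [seq eterm i j rs | rs <- tuples a i (j - i)].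

Definition fterm (j i : nat) (rs : seq nat) : lser A :=
  let R := rk i rs in
  let num := Pev j (p j.-1 (R j.-1) + 1) *
             \prod_(k <- iota i.+1 (j.-1 - i)) Pev' k (R k) (p k.-1 (R k.-1) + 1) in
  let den := \prod_(k <- iota i (j - i)) Pinv' k (R k) in
  let E := \prod_(k <- iota i (j - i)) gqi G k (R k) in
  lmul (lconst (num * den)) (lmul (lgeom (p i (R i) + 1)) (lconst E)).

Definition fD (j i : nat) : lser A :=
  if i == j then lconst 1
  else lsum [seq fterm j i rs | rs <- tuples a i (j - i)].

Definition TD (al be : nat) : lser A :=
  lsum [seq lmul (fD al i) (lmul (gD i) (eD i be)) | i <- iota 1 (minn al be)].
End TD.

(* Main.v *)
Require Import Defs.
From HB Require Import structures.
From mathcomp Require Import all_boot all_order all_algebra.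
From mathcomp Require Import boolp zify.
Import Order.TTheory GRing.Theory Num.Theory.
Local Open Scope ring_scope.

Set Implicit Arguments.
Unset Strict Implicit.
Unset Printing Implicit Defensive.

(**
  Every entry of T_D(z) is a polynomial in z.  Indeed the i-th summand
  f_{alpha i} g_i e_{i beta} of T_D(z)_{alpha beta} has only simple poles, at
  the points p_{i-1,s} + 1 and p_{i,s} + 1 once the coefficients are moved to
  the right, and the residues at p_{i,s} + 1 of the summands i and i + 1 are
  opposite.

  The theorem is then read off from degrees in z: f_{alpha i} and e_{i beta}
  have degree -1 off the diagonal, while g_i is z + ... for i <= r and
  z^-1 + ... for i > r.  Hence both off-diagonal blocks have degree at most 0,
  with constant terms the leading coefficients of f_{alpha beta}, resp.
  e_{alpha beta}, and the coefficient of z^-1 in the lower right block, which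
  vanishes, equals K * Kbar + I_r.
*)

(** * The ring of Laurent series in z^-1 *)

Record laurent (A : nzRingType) := Laurent {
  coefl : int -> A;
  coefl_bound : exists d : int, forall m, d < m -> coefl m = 0 }.

HB.instance Definition _ (A : nzRingType) := gen_eqMixin (laurent A).
HB.instance Definition _ (A : nzRingType) := gen_choiceMixin (laurent A).

Section LaurentRing.
Variable A : nzRingType.
Implicit Types (s t : lser A) (x y : laurent A) (m d e : int).

Lemma laurentP x y : (forall m, coefl x m = coefl y m) -> x = y.
Proof.
case: x y => f bf [g bg] /= /funext fg.
by rewrite fg in bf *; congr Laurent; apply: Prop_irrelevance.
Qed.

Lemma lcoef_bound s : exists d, forall m, d < m -> lcoef s m = 0.
Proof.
by exists (ldeg s) => m; rewrite /lcoef; case E: (ldeg s - m)%R => [k|k] //; lia.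
Qed.

Definition to_laurent s : laurent A := Laurent (lcoef_bound s).

Definition of_laurent x : lser A :=
  let d := projT1 (cid (coefl_bound x)) in LSer d (fun k => coefl x (d - k%:Z)).

Lemma lcoefB s (u i : nat) :
  lcoef s (ldeg s + u%:Z - i%:Z) = if (i < u)%N then 0 else lco s (i - u).
Proof.
rewrite /lcoef; case: ltnP => h.
  by case E: (_ - _)%R => [k|k] //; lia.
have -> : ldeg s - (ldeg s + u%:Z - i%:Z) = Posz (i - u) by lia.
by [].
Qed.

Lemma of_laurentK : cancel of_laurent to_laurent.
Proof.
move=> x; apply: laurentP => m; rewrite /= /of_laurent /lcoef /=.
case: (cid _) => d dP /=.
case E: (d - m)%R => [k|k]; first by congr (coefl x _); lia.
by rewrite dP //; lia.
Qed.

Definition trunc (N : nat) s : {poly A} := \poly_(i < N) lco s i.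

Lemma lco_mul s t (N k : nat) :
  (k < N)%N -> lco (lmul s t) k = (trunc N s * trunc N t)`_k.
Proof.
move=> kN; rewrite coefM /=; apply: eq_bigr => i _; rewrite !coef_poly.
by rewrite !ifT //; have := ltn_ord i; lia.
Qed.

(* The coefficients of a product, computed from any upper bounds of the two
   degrees: this is what makes the product well defined on [laurent]. *)
Lemma lcoef_mul s t d e (k : nat) : ldeg s <= d -> ldeg t <= e ->
  lcoef (lmul s t) (d + e - k%:Z) =
  \sum_(i < k.+1) lcoef s (d - i%:Z) * lcoef t (e - (k - i)%N%:Z).
Proof.
move=> sd te.
have [u du] : exists u : nat, d = ldeg s + u%:Z by exists `|d - ldeg s|%N; lia.
have [v ev] : exists v : nat, e = ldeg t + v%:Z by exists `|e - ldeg t|%N; lia.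
have -> : d + e - k%:Z = ldeg (lmul s t) + (u + v)%N%:Z - k%:Z by rewrite /=; lia.
rewrite lcoefB du ev.
pose f := 'X^u * trunc k.+1 s; pose g := 'X^v * trunc k.+1 t.
transitivity ((f * g)`_k); last first.
  rewrite coefM; apply: eq_bigr => i _; rewrite !lcoefB !coefXnM !coef_poly.
  have ik := ltn_ord i.
  have -> : (i - u < k.+1)%N by lia.
  by have -> : (k - i - v < k.+1)%N by lia.
have -> : f * g = 'X^(u + v) * (trunc k.+1 s * trunc k.+1 t).
  by rewrite /f /g exprD -!mulrA; congr (_ * _); rewrite mulrA commr_polyXn mulrA.
by rewrite coefXnM; case: ltnP => // _; apply: lco_mul; lia.
Qed.

Lemma lcoef_gt s m : ldeg s < m -> lcoef s m = 0.
Proof. by rewrite /lcoef; case E: (ldeg s - m)%R => [k|k] //; lia. Qed.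

Lemma ldeg_of_laurent x m : ldeg (of_laurent x) < m -> coefl x m = 0.
Proof. by move=> /lcoef_gt h; rewrite -{1}[x]of_laurentK /= h. Qed.

Lemma lser_ext s t : ldeg s = ldeg t -> lco s =1 lco t -> to_laurent s = to_laurent t.
Proof.
by case: s t => [d f] [e g] /= -> fg; apply: laurentP => m; rewrite /= /lcoef /=; case: (e - m)%R.
Qed.

Lemma lcoef_add s t m : lcoef (ladd s t) m = lcoef s m + lcoef t m.
Proof.
rewrite [LHS]/lcoef /=; set d := Num.max _ _.
have [sd td] : ldeg s <= d /\ ldeg t <= d by rewrite /d !le_max !lexx orbT.
move: (d : int) sd td => e sd td; case E: (e - m)%R => [k|k].
  by have -> : e - k%:Z = m by lia.
by rewrite !lcoef_gt ?addr0 //; lia.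
Qed.

Definition addl x y := to_laurent (ladd (of_laurent x) (of_laurent y)).
Definition mull x y := to_laurent (lmul (of_laurent x) (of_laurent y)).
Definition oppl x := to_laurent
  (LSer (ldeg (of_laurent x)) (fun k => - lco (of_laurent x) k)).

Lemma coefl_add x y m : coefl (addl x y) m = coefl x m + coefl y m.
Proof. by rewrite -{2}[x]of_laurentK -{2}[y]of_laurentK /= lcoef_add. Qed.

Lemma coefl_opp x m : coefl (oppl x) m = - coefl x m.
Proof.
rewrite -{2}[x]of_laurentK /= /lcoef /=.
by case: (_ - _)%R => //; rewrite oppr0.
Qed.

Lemma to_laurent_add s t : to_laurent (ladd s t) = addl (to_laurent s) (to_laurent t).
Proof. by apply: laurentP => m; rewrite coefl_add /= lcoef_add. Qed.

Lemma to_laurent_mul s t : to_laurent (lmul s t) = mull (to_laurent s) (to_laurent t).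
Proof.
apply: laurentP => m; rewrite /mull /=.
set s' := of_laurent _; set t' := of_laurent _.
have ss' k : lcoef s' k = lcoef s k by rewrite -[RHS]/(coefl (to_laurent s) k) -[X in coefl X]of_laurentK.
have tt' k : lcoef t' k = lcoef t k by rewrite -[RHS]/(coefl (to_laurent t) k) -[X in coefl X]of_laurentK.
move: s' t' ss' tt' => s' t' ss' tt'.
pose d := Num.max (ldeg s) (ldeg s'); pose e := Num.max (ldeg t) (ldeg t').
have [dem|mde] := ltP (d + e) m.
  have [sd [sd' [te te']]] : ldeg s <= d /\ ldeg s' <= d /\ ldeg t <= e /\ ldeg t' <= e.
    by rewrite /d /e !le_max !lexx !orbT.
  move: (d : int) (e : int) sd sd' te te' dem => {}d {}e sd sd' te te' dem.
  by rewrite !lcoef_gt //=; lia.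
have [k ->] : exists k : nat, m = d + e - k%:Z.
  by move: (d : int) (e : int) mde => {}d {}e mde; exists `|(d + e - m)%R|%N; lia.
rewrite !lcoef_mul ?le_max ?lexx ?orbT //.
by apply: eq_bigr => i _; rewrite ss' tt'.
Qed.

Lemma lmulA s t u : to_laurent (lmul s (lmul t u)) = to_laurent (lmul (lmul s t) u).
Proof.
apply: lser_ext => [|k]; first by rewrite /= addrA.
have trM v w : forall i, (i < k.+1)%N ->
    (trunc k.+1 (lmul v w))`_i = (trunc k.+1 v * trunc k.+1 w)`_i.
  by move=> i ik; rewrite coef_poly ik; apply: lco_mul.
rewrite !(@lco_mul _ _ k.+1) // !coefM.
have -> : \sum_(j < k.+1) (trunc k.+1 s)`_j * (trunc k.+1 (lmul t u))`_(k - j) =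
    (trunc k.+1 s * (trunc k.+1 t * trunc k.+1 u))`_k.
  by rewrite coefM; apply: eq_bigr => i _; rewrite trM // ltnS leq_subr.
by rewrite mulrA coefM; apply: eq_bigr => i _; rewrite trM.
Qed.

Definition constl (c : A) := to_laurent (lconst c).

Lemma coefl_const c m : coefl (constl c) m = if m == 0 then c else 0.
Proof. by rewrite /= /lcoef /= sub0r; case: m => [[|k]|k]. Qed.

Fact addlA : associative addl.
Proof. by move=> x y z; apply: laurentP => m; rewrite !coefl_add addrA. Qed.
Fact addlC : commutative addl.
Proof. by move=> x y; apply: laurentP => m; rewrite !coefl_add addrC. Qed.
Fact add0l : left_id (constl 0) addl.
Proof. by move=> x; apply: laurentP => m; rewrite !coefl_add coefl_const if_same add0r. Qed.
Fact addNl : left_inverse (constl 0) oppl addl.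
Proof.
by move=> x; apply: laurentP => m; rewrite !coefl_add coefl_const coefl_opp if_same addNr.
Qed.

HB.instance Definition _ :=
  GRing.isZmodule.Build (laurent A) addlA addlC add0l addNl.

Fact mullA : associative mull.
Proof.
move=> x y z; rewrite -[x]of_laurentK -[y]of_laurentK -[z]of_laurentK.
by rewrite -!to_laurent_mul lmulA.
Qed.

Fact mul1l : left_id (constl 1) mull.
Proof.
move=> x; rewrite -{2}[x]of_laurentK -{1}[x]of_laurentK -to_laurent_mul.
apply: lser_ext => [|k]; first by rewrite /= add0r.
by rewrite /= big_ord_recl mul1r subn0 big1 ?addr0 // => i _; rewrite mul0r.
Qed.

Fact mull1 : right_id (constl 1) mull.
Proof.
move=> x; rewrite -{2}[x]of_laurentK -{1}[x]of_laurentK -to_laurent_mul.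
apply: lser_ext => [|k]; first by rewrite /= addr0.
rewrite /= big_ord_recr /= subnn mulr1 big1 ?add0r // => i _.
by rewrite subn_eq0 leqNgt ltn_ord mulr0.
Qed.

Lemma coefl_mul_le x y d e (k : nat) :
  (forall m, d < m -> coefl x m = 0) -> (forall m, e < m -> coefl y m = 0) ->
  coefl (mull x y) (d + e - k%:Z) =
  \sum_(i < k.+1) coefl x (d - i%:Z) * coefl y (e - (k - i)%N%:Z).
Proof.
move=> xd ye.
pose s := LSer d (fun k => coefl x (d - k%:Z)).
pose t := LSer e (fun k => coefl y (e - k%:Z)).
have -> : x = to_laurent s.
  apply: laurentP => m; rewrite /= /lcoef /=.
  case E: (d - m)%R => [j|j]; first by congr (coefl x _); lia.
  by apply: xd; lia.
have -> : y = to_laurent t.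
  apply: laurentP => m; rewrite /= /lcoef /=.
  case E: (e - m)%R => [j|j]; first by congr (coefl y _); lia.
  by apply: ye; lia.
by rewrite -to_laurent_mul /= lcoef_mul.
Qed.

Lemma coefl_mul_gt x y d e m :
  (forall m, d < m -> coefl x m = 0) -> (forall m, e < m -> coefl y m = 0) ->
  d + e < m -> coefl (mull x y) m = 0.
Proof.
move=> xd ye dem.
have [k mE] : exists k : nat, m = d + k.+1%:Z + e - 0%:Z.
  by exists `|(m - d - e - 1)%R|%N; lia.
rewrite mE (@coefl_mul_le x y (d + k.+1%:Z) e) => [|j dj|//]; last by apply: xd; lia.
by rewrite big_ord1 xd ?mul0r // subr0 ltrDl.
Qed.

Lemma common_bound x y :
  exists d, forall m, d < m -> coefl x m = 0 /\ coefl y m = 0.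
Proof.
exists (Num.max (ldeg (of_laurent x)) (ldeg (of_laurent y))) => m.
by rewrite gt_max => /andP[/ldeg_of_laurent-> /ldeg_of_laurent->].
Qed.

Fact mullDl : left_distributive mull addl.
Proof.
move=> x y z; apply: laurentP => m.
have [d dP] := common_bound x y; have [e eP] := common_bound z (addl x y).
pose d' := Num.max m d; pose e' := Num.max 0 e.
have [zb sb] : (forall m, e' < m -> coefl z m = 0) /\ (forall m, d' < m -> coefl x m = 0 /\ coefl y m = 0).
  by split=> j jb; [apply: (eP j _).1|apply: dP]; move: jb; rewrite gt_max => /andP[].
have [k ->] : exists k : nat, m = d' + e' - k%:Z.
  have [md' e0] : m <= d' /\ 0 <= e' by rewrite !le_max !lexx.
  move: (d' : int) (e' : int) md' e0 => d2 e2 md e0.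
  by exists `|(d2 + e2 - m)%R|%N; lia.
rewrite coefl_add !(@coefl_mul_le _ _ d' e') //; try by move=> j /sb[].
  by rewrite -big_split; apply: eq_bigr => i _; rewrite coefl_add mulrDl.
by move=> j /sb[xj yj]; rewrite coefl_add xj yj addr0.
Qed.

Fact mullDr : right_distributive mull addl.
Proof.
move=> z x y; apply: laurentP => m.
have [d dP] := common_bound x y; have [e eP] := common_bound z (addl x y).
pose d' := Num.max m d; pose e' := Num.max 0 e.
have [zb sb] : (forall m, e' < m -> coefl z m = 0) /\ (forall m, d' < m -> coefl x m = 0 /\ coefl y m = 0).
  by split=> j jb; [apply: (eP j _).1|apply: dP]; move: jb; rewrite gt_max => /andP[].
have [k ->] : exists k : nat, m = e' + d' - k%:Z.
  have [md' e0] : m <= d' /\ 0 <= e' by rewrite !le_max !lexx.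
  move: (d' : int) (e' : int) md' e0 => d2 e2 md e0.
  by exists `|(d2 + e2 - m)%R|%N; lia.
rewrite coefl_add !(@coefl_mul_le _ _ e' d') //; try by move=> j /sb[].
  by rewrite -big_split; apply: eq_bigr => i _; rewrite coefl_add mulrDr.
by move=> j /sb[xj yj]; rewrite coefl_add xj yj addr0.
Qed.

Fact onel_neq0 : constl 1 != constl 0.
Proof.
apply/eqP => /(congr1 (fun x => coefl x 0)); rewrite !coefl_const eqxx.
exact/eqP/oner_neq0.
Qed.

HB.instance Definition _ := GRing.Zmodule_isNzRing.Build (laurent A)
  mullA mul1l mull1 mullDl mullDr onel_neq0.

Lemma coeflD x y m : coefl (x + y) m = coefl x m + coefl y m.
Proof. exact: coefl_add. Qed.

Definition coefz m x := coefl x m.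

Fact coefz_is_zmod_morphism m : zmod_morphism (coefz m).
Proof. by move=> x y; rewrite /coefz coeflD coefl_opp. Qed.

HB.instance Definition _ m :=
  GRing.isZmodMorphism.Build (laurent A) A (coefz m) (coefz_is_zmod_morphism m).

Lemma coeflB x y m : coefl (x - y) m = coefl x m - coefl y m.
Proof. exact: (raddfB (coefz m)). Qed.

Lemma coefl_sum I (l : seq I) (P : pred I) (F : I -> laurent A) m :
  coefl (\sum_(i <- l | P i) F i) m = \sum_(i <- l | P i) coefl (F i) m.
Proof. exact: (raddf_sum (coefz m)). Qed.

Fact constl_is_zmod_morphism : zmod_morphism constl.
Proof.
move=> c e; apply: laurentP => m; rewrite coeflB !coefl_const.
by case: ifP => // _; rewrite subr0.
Qed.

Fact constl_is_monoid_morphism : monoid_morphism constl.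
Proof.
split=> // c e; rewrite -[RHS]to_laurent_mul; apply: lser_ext => // k /=.
rewrite big_ord_recl /= subn0 big1 ?addr0 ?(fun_if (fun u => c * u)) ?mulr0 // => i _.
by rewrite mul0r.
Qed.

HB.instance Definition _ :=
  GRing.isZmodMorphism.Build A (laurent A) constl constl_is_zmod_morphism.
HB.instance Definition _ :=
  GRing.isMonoidMorphism.Build A (laurent A) constl constl_is_monoid_morphism.

Lemma to_laurentD s t : to_laurent (ladd s t) = to_laurent s + to_laurent t.
Proof. exact: to_laurent_add. Qed.

Lemma to_laurentM s t : to_laurent (lmul s t) = to_laurent s * to_laurent t.
Proof. exact: to_laurent_mul. Qed.

Lemma to_laurent_sum (l : seq (lser A)) : to_laurent (lsum l) = \sum_(s <- l) to_laurent s.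
Proof. by elim: l => [|s l IH]; rewrite (big_nil, big_cons) //= to_laurentD IH. Qed.

Lemma to_laurent_prod (l : seq (lser A)) : to_laurent (lprod l) = \prod_(s <- l) to_laurent s.
Proof. by elim: l => [|s l IH]; rewrite (big_nil, big_cons) //= to_laurentM IH. Qed.

Definition zl : laurent A := to_laurent (llin 0).
Definition geoml (c : A) : laurent A := to_laurent (lgeom c).

Lemma coefl_zl m : coefl zl m = (m == 1)%:R.
Proof.
rewrite /= /lcoef /=; have [->|m1] := eqVneq m 1; first by rewrite subrr.
case E: (1 - m)%R => [[|[|k]]|k] //; first by lia.
by rewrite oppr0.
Qed.

Lemma llinE c : to_laurent (llin c) = zl - constl c.
Proof.
apply: laurentP => m; rewrite coeflB coefl_zl coefl_const /= /lcoef /=.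
have [->|m1] := eqVneq m 1; first by rewrite subrr subr0.
have [->|m0] := eqVneq m 0; first by rewrite subr0 sub0r.
by rewrite subrr; case E: (1 - m)%R => [[|[|k]]|k] //; lia.
Qed.

Lemma coefl_constM c x m : coefl (constl c * x) m = c * coefl x m.
Proof.
have [d dP] := coefl_bound x.
have [k mE] : exists k : nat, m = 0 + Num.max m d - k%:Z.
  have : m <= Num.max m d by rewrite le_max lexx.
  by move: (Num.max m d : int) => e me; exists `|(e - m)%R|%N; lia.
have xb j : Num.max m d < j -> coefl x j = 0 by rewrite gt_max => /andP[_ /dP].
rewrite {1}mE (@coefl_mul_le (constl c) x 0 (Num.max m d)) //.
  rewrite big_ord_recl big1 ?addr0 => [|i _]; last by rewrite coefl_const mul0r.
  by rewrite coefl_const subn0 /=; congr (c * coefl x _); rewrite [in RHS]mE add0r.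
by move=> j j0; rewrite coefl_const gt_eqF.
Qed.

Lemma coefl_zM x m : coefl (zl * x) m = coefl x (m - 1).
Proof.
have [d dP] := coefl_bound x.
pose e := Num.max (m - 1) d.
have [k mE] : exists k : nat, m = 1 + e - k%:Z.
  have : m - 1 <= e by rewrite le_max lexx.
  by move: (e : int) => f me; exists `|(f - (m - 1))%R|%N; lia.
have xb j : e < j -> coefl x j = 0 by rewrite gt_max => /andP[_ /dP].
rewrite {1}mE (@coefl_mul_le zl x 1 e) //.
  rewrite big_ord_recl big1 ?addr0 => [|i _]; last by rewrite coefl_zl lift0 [_ == _]negbTE ?mul0r //; lia.
  rewrite coefl_zl subn0 (_ : (_ == _) = true) ?mul1r //; congr (coefl x _).
  by rewrite [in RHS]mE addrAC [1 + e]addrC addrK.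
by move=> j j0; rewrite coefl_zl gt_eqF.
Qed.

Lemma coefl_Mz x m : coefl (x * zl) m = coefl x (m - 1).
Proof.
have [d dP] := coefl_bound x.
pose e := Num.max (m - 1) d.
have [k mE] : exists k : nat, m = e + 1 - k%:Z.
  have : m - 1 <= e by rewrite le_max lexx.
  by move: (e : int) => f me; exists `|(f - (m - 1))%R|%N; lia.
have xb j : e < j -> coefl x j = 0 by rewrite gt_max => /andP[_ /dP].
rewrite {1}mE (@coefl_mul_le x zl e 1) //.
  rewrite big_ord_recr big1 => [|i _].
    rewrite coefl_zl [(k - _)%N]subnn (_ : (_ == _) = true) // mulr1 [LHS]add0r; congr (coefl x _).
    by rewrite [in RHS]mE addrAC addrK.
  by rewrite coefl_zl /= [_ == _]negbTE ?mulr0 //; have := ltn_ord i; lia.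
by move=> j j0; rewrite coefl_zl gt_eqF.
Qed.

Lemma zl_comm x : zl * x = x * zl.
Proof. by apply: laurentP => m; rewrite coefl_zM coefl_Mz. Qed.

Lemma coefl_geom c m :
  coefl (geoml c) m = if (-1 - m)%R is Posz k then c ^+ k else 0.
Proof. by []. Qed.

Lemma mul_geoml c : (zl - constl c) * geoml c = 1.
Proof.
apply: laurentP => m; rewrite mulrBl coeflB coefl_zM coefl_constM !coefl_geom.
rewrite [RHS]coefl_const; case: eqVneq => [->|m0].
  by rewrite (_ : -1 - (0 - 1) = 0 :> int) // (_ : -1 - 0 = Negz 0 :> int) // mulr0 subr0.
case E: (-1 - m)%R => [k|k]; case F: (-1 - (m - 1))%R => [j|j]; try lia.
- have -> : j = k.+1 by lia.
  by rewrite exprS subrr.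
- by rewrite mulr0 subr0.
Qed.

Lemma geoml_mul c : geoml c * (zl - constl c) = 1.
Proof.
suff cc : geoml c * constl c = constl c * geoml c.
  by rewrite mulrBr -zl_comm cc -mulrBl mul_geoml.
rewrite -!to_laurentM; apply: lser_ext => // k /=.
rewrite big_ord_recr big_ord_recl /= subnn subn0 -exprSr exprS !big1 ?add0r ?addr0 // => i _.
  by rewrite mul0r.
by rewrite subn_eq0 leqNgt ltn_ord mulr0.
Qed.

End LaurentRing.

(** * Regularity of the entries of T_D *)

Section Commutant.
Variables (B : nzRingType) (Y : B -> Prop).
Implicit Types x y u v : B.

Definition commutant x := forall y, Y y -> GRing.comm y x.

Lemma comm_inv y u v : u * v = 1 -> v * u = 1 -> GRing.comm y u -> GRing.comm y v.
Proof.
move=> uv vu yu; rewrite /GRing.comm -[LHS]mul1r -vu -mulrA [u * _]mulrA -yu.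
by rewrite -!mulrA uv mulr1.
Qed.

Lemma commutant1 : commutant 1. Proof. by move=> y _; exact: commr1. Qed.
Lemma commutantN x : commutant x -> commutant (- x).
Proof. by move=> h y Yy; apply/commrN/h. Qed.
Lemma commutantD x y : commutant x -> commutant y -> commutant (x + y).
Proof. by move=> hx hy t Yt; apply: commrD; [apply: hx|apply: hy]. Qed.
Lemma commutantB x y : commutant x -> commutant y -> commutant (x - y).
Proof. by move=> hx hy t Yt; apply: commrB; [apply: hx|apply: hy]. Qed.
Lemma commutantM x y : commutant x -> commutant y -> commutant (x * y).
Proof. by move=> hx hy t Yt; apply: commrM; [apply: hx|apply: hy]. Qed.
Lemma commutantV u v : u * v = 1 -> v * u = 1 -> commutant u -> commutant v.
Proof. by move=> uv vu hu y Yy; apply: comm_inv uv vu (hu y Yy). Qed.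
Lemma commutant_sum (l : seq nat) (P : pred nat) (F : nat -> B) :
  (forall s, s \in l -> P s -> commutant (F s)) -> commutant (\sum_(s <- l | P s) F s).
Proof.
by move=> h y Yy; rewrite big_seq_cond; apply: commr_sum => s /andP[sl Ps]; apply: h.
Qed.
Lemma commutant_prod (l : seq nat) (P : pred nat) (F : nat -> B) :
  (forall s, s \in l -> P s -> commutant (F s)) -> commutant (\prod_(s <- l | P s) F s).
Proof.
by move=> h y Yy; rewrite big_seq_cond; apply: commr_prod => s /andP[sl Ps]; apply: h.
Qed.

End Commutant.

Section ProductsOfCommuting.
Variable B : nzRingType.

Lemma prodr_pull (l : seq nat) (P : pred nat) (F : nat -> B) s : uniq l -> s \in l -> P s ->
  (forall t, t \in l -> GRing.comm (F s) (F t)) ->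
  \prod_(t <- l | P t) F t = F s * \prod_(t <- l | P t && (t != s)) F t.
Proof.
elim: l => //= u l IH /andP[ul ll]; rewrite inE => /orP[/eqP->|sl] Ps cF.
  rewrite !big_cons Ps eqxx /=; congr (_ * _); rewrite big_seq_cond [RHS]big_seq_cond.
  apply: eq_bigl => t; case: eqVneq => [->|_]; rewrite ?andbT //.
  by rewrite (negPf ul) !andbF.
rewrite !big_cons; have us : u != s by apply: contraNneq ul => ->.
have cl t : t \in l -> GRing.comm (F s) (F t) by move=> tl; apply: cF; rewrite inE tl orbT.
rewrite us andbT IH //; case: (P u) => //.
by rewrite !mulrA cF // inE eqxx.
Qed.

Lemma prodrM_comm_seq (l : seq nat) (P : pred nat) (F G : nat -> B) :
  (forall s t, s \in l -> t \in l -> GRing.comm (F s) (G t)) ->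
  \prod_(s <- l | P s) (F s * G s) = \prod_(s <- l | P s) F s * \prod_(s <- l | P s) G s.
Proof.
elim: l => [|u l IH] c; first by rewrite !big_nil mulr1.
have IH' : \prod_(s <- l | P s) (F s * G s) = \prod_(s <- l | P s) F s * \prod_(s <- l | P s) G s.
  by apply: IH => s t sl tl; apply: c; rewrite inE ?sl ?tl orbT.
rewrite !big_cons IH'; case: (P u) => //; rewrite -!mulrA; congr (_ * _).
rewrite !mulrA; congr (_ * _).
rewrite big_seq_cond; apply: commr_prod => s /andP[sl _].
by apply/commr_sym/c; rewrite inE ?eqxx ?sl ?orbT.
Qed.

End ProductsOfCommuting.

Section Algebra.
Variables (B : nzRingType) (r : nat) (G : gens B).
Hypothesis HG : rels r G.

Local Notation a := (acoef r).
Local Notation p := (gp G).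
Local Notation P := (Pev r G).
Local Notation P' := (Pev' r G).
Local Notation iP' := (Pinv' r G).
Local Notation "s \rng i" := (s \in iota 1 (a i)) (at level 70).

Lemma rngP i s : s \rng i -> [&& 0 < i, i < 2 * r, 0 < s & s <= a i]%N.
Proof. by rewrite mem_iota /acoef; lia. Qed.

Lemma pp_comm i s j t : s \rng i -> t \rng j -> GRing.comm (p i s) (p j t).
Proof. by move=> /rngP si /rngP tj; case: HG => h *; apply: h. Qed.

Lemma qiq i s : s \rng i -> gqi G i s * gq G i s = 1.
Proof. by move=> /rngP si; case: HG => _ _ h _ _; case: (h i s si). Qed.

Lemma qi_comm i s j t : s \rng i -> t \rng j -> GRing.comm (gqi G i s) (gqi G j t).
Proof. by move=> /rngP si /rngP tj; case: HG => _ h _ _ _; case: (h _ _ _ _ si tj). Qed.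

Lemma qip_comm i s j t : s \rng i -> t \rng j -> (i, s) != (j, t) ->
  GRing.comm (gqi G i s) (p j t).
Proof.
move=> /rngP si /rngP tj; rewrite -pair_eqE /= => ne; apply/eqP; rewrite -subr_eq0.
by case: HG => _ _ _ h _; case: (h i s j t si tj) => _ ->; rewrite (negPf ne) mul0r.
Qed.

Lemma qp_comm i s j t : s \rng i -> t \rng j -> (i, s) != (j, t) ->
  GRing.comm (gq G i s) (p j t).
Proof.
move=> /rngP si /rngP tj; rewrite -pair_eqE /= => ne; apply/eqP; rewrite -subr_eq0.
by case: HG => _ _ _ h _; case: (h i s j t si tj) => -> _; rewrite (negPf ne) oppr0 mul0r.
Qed.

Lemma qip_shift i s : s \rng i -> gqi G i s * p i s = (p i s + 1) * gqi G i s.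
Proof.
move=> /rngP si; case: HG => _ _ _ h _; case: (h i s i s si si) => _ /eqP.
by rewrite !eqxx /= mul1r subr_eq mulrDl mul1r addrC => /eqP.
Qed.

Lemma ginvP i s t : s \rng i -> t \rng i -> s != t ->
  (p i s - p i t) * ginv G i s t 0 = 1 /\ ginv G i s t 0 * (p i s - p i t) = 1.
Proof.
move=> /rngP si /rngP ti st; case: HG => _ _ _ _ h.
by case: (h i s t 0 si ti st); rewrite addr0.
Qed.

Section CommutantP.
Variable Y : B -> Prop.

Lemma commutant_P i x : commutant Y x ->
  (forall s, s \rng i -> commutant Y (p i s)) -> commutant Y (P i x).
Proof. by move=> xY pY; apply: commutant_prod => s si _; apply: commutantB; auto. Qed.

Lemma commutant_P' i t x : commutant Y x ->
  (forall s, s \rng i -> s != t -> commutant Y (p i s)) -> commutant Y (P' i t x).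
Proof. by move=> xY pY; apply: commutant_prod => s si st; apply: commutantB; auto. Qed.

Lemma commutant_iP' i t : t \rng i ->
  (forall s, s \rng i -> commutant Y (p i s)) -> commutant Y (iP' i t).
Proof.
move=> ti pY; apply: commutant_prod => s si st.
rewrite eq_sym in st; have [h1 h2] := ginvP ti si st.
by apply: commutantV h1 h2 _; apply: commutantB; auto.
Qed.

End CommutantP.

(* The double commutant of the p's: a commutative subring which, unlike the
   subring they generate, is closed under inverses. *)
Definition pcomm : B -> Prop :=
  commutant (fun y => forall i s, s \rng i -> GRing.comm y (p i s)).

Lemma pcommC x y : pcomm x -> pcomm y -> GRing.comm x y.
Proof.
move=> hx hy; apply: hy => i s si; apply/commr_sym/hx => j t tj.
exact: pp_comm.
Qed.

Lemma pcomm_p i s : s \rng i -> pcomm (p i s).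
Proof. by move=> si y; apply. Qed.

Lemma pcomm1 : pcomm 1. Proof. exact: commutant1. Qed.

Lemma pcomm_p1 i s : s \rng i -> pcomm (p i s + 1).
Proof. by move=> si; apply: commutantD (pcomm_p si) pcomm1. Qed.

Lemma pcomm_P i x : pcomm x -> pcomm (P i x).
Proof. by move=> xY; apply: commutant_P => // s; apply: pcomm_p. Qed.

Lemma pcomm_P' i t x : pcomm x -> pcomm (P' i t x).
Proof. by move=> xY; apply: commutant_P' => // s si _; apply: pcomm_p. Qed.

Lemma pcomm_iP' i t : t \rng i -> pcomm (iP' i t).
Proof. by move=> ti; apply: commutant_iP' => // s; apply: pcomm_p. Qed.

Lemma P_pull i s x : s \rng i -> pcomm x -> P i x = (x - p i s) * P' i s x.
Proof.
move=> si hx; rewrite /Pev (@prodr_pull _ _ xpredT _ s) ?iota_uniq // => t ti.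
by apply: pcommC; apply: commutantB => //; apply: pcomm_p.
Qed.

Lemma pcomm_ginv i s t : s \rng i -> t \rng i -> s != t -> pcomm (ginv G i s t 0).
Proof.
move=> si ti st; have [h1 h2] := ginvP si ti st.
by apply: commutantV h1 h2 _; apply: commutantB; apply: pcomm_p.
Qed.

Lemma mul_P'_iP' i s : s \rng i -> P' i s (p i s) * iP' i s = 1.
Proof.
move=> si; rewrite /Pev' /Pinv' [X in X * _]big_seq_cond [X in _ * X]big_seq_cond.
rewrite -[X in X * _]big_filter -[X in _ * X]big_filter -prodrM_comm_seq => [|t u]; last first.
  rewrite !mem_filter => /andP[/andP[ti ts] _] /andP[/andP[ui us] _].
  rewrite eq_sym in us; apply: pcommC; last exact: pcomm_ginv.
  by apply: commutantB; apply: pcomm_p.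
rewrite big_seq big1 // => t; rewrite mem_filter => /andP[/andP[ti ts] _].
by rewrite eq_sym in ts; have [] := ginvP si ti ts.
Qed.

(* Lagrange interpolation of the constant 1 at the nodes p_{i,s}, s in l. *)
Lemma lagrange (i : nat) (l : seq nat) y : uniq l -> {subset l <= iota 1 (a i)} ->
  l != [::] -> pcomm y ->
  \sum_(s <- l) \prod_(t <- l | t != s) ginv G i s t 0 * \prod_(t <- l | t != s) (y - p i t) = 1.
Proof.
elim: l y => //= u l IH y /andP[ul uql] li _ hy.
have ui : u \rng i by apply: li; rewrite inE eqxx.
have {}li : {subset l <= iota 1 (a i)} by move=> t tl; apply: li; rewrite inE tl orbT.
have neu t : t \in l -> t != u by move=> tl; apply: contraNneq ul => <-.
have [->|ln] := eqVneq l [::].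
  by rewrite big_seq1 !big_cons eqxx /= !big_nil mulr1.
pose w s t := ginv G i s t 0; pose d t := y - p i t.
pose W s := \prod_(t <- l | t != s) w s t.
pose A := \prod_(t <- l) w u t; pose D := \prod_(t <- l) d t.
have w_comm s t : s \in u :: l -> t \in u :: l -> s != t -> pcomm (w s t).
  rewrite !inE => sl tl st; apply: pcomm_ginv => //.
    by case/orP: sl => [/eqP->|/li].
  by case/orP: tl => [/eqP->|/li].
have hd t : t \in l -> pcomm (d t) by move=> /li ti; apply: commutantB => //; apply: pcomm_p.
have hW s : s \in l -> pcomm (W s).
  move=> sl; apply: commutant_prod => t tl ts; rewrite eq_sym in ts.
  by apply: w_comm; rewrite // inE ?sl ?tl orbT.
have wN s : s \in l -> w s u = - w u s.
  move=> sl; have su := neu _ sl; have us : u != s by rewrite eq_sym.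
  have [h1 h2] := ginvP (li _ sl) ui su; have [h3 h4] := ginvP ui (li _ sl) us.
  by rewrite -[LHS]mul1r -h4 -(opprB (p i s)) mulrN mulNr -mulrA h1 mulr1.
have restP (F : nat -> B) : \prod_(t <- l | t != u) F t = \prod_(t <- l) F t.
  rewrite big_seq_cond [RHS]big_seq; apply: eq_bigl => t.
  by case tl: (t \in l); rewrite //= neu.
have hA : A = - \sum_(s <- l) w s u * W s.
  rewrite -[A]mul1r -(IH (p i u)) //; last exact: pcomm_p.
  rewrite mulr_suml -sumrN; apply: eq_big_seq => s sl.
  have su := neu _ sl; have us : u != s by rewrite eq_sym.
  have inu t : t \in l -> pcomm (w u t).
    by move=> tl; apply: w_comm; rewrite ?inE ?eqxx ?tl ?orbT // eq_sym neu.
  rewrite /A (@prodr_pull _ _ xpredT _ s) // => [|t tl]; last by apply: pcommC; apply: inu.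
  have cE : pcomm (\prod_(t <- l | t != s) (p i u - p i t)).
    by apply: commutant_prod => t /li ti _; apply: commutantB; apply: pcomm_p.
  rewrite -mulrA [_ * (w u s * _)]mulrA (pcommC cE (inu _ sl)) -[w u s * _ * _]mulrA.
  rewrite -prodrM_comm_seq => [|t v tl vl]; last first.
    by apply: pcommC; [apply: commutantB; apply: pcomm_p => //; apply: li|apply: inu].
  have -> : \prod_(t <- l | t != s) ((p i u - p i t) * w u t) = 1.
    rewrite big_seq_cond big1 // => t /andP[tl _].
    have ut : u != t by rewrite eq_sym neu.
    by have [] := ginvP ui (li _ tl) ut.
  by rewrite mulr1 wN // mulNr opprK (pcommC (hW _ sl) (inu _ sl)).
rewrite big_cons !big_cons eqxx /= !restP -/A -/D.
have -> : \sum_(s <- l) \prod_(t <- u :: l | t != s) ginv G i s t 0 *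
      \prod_(t <- u :: l | t != s) (y - p i t)
    = \sum_(s <- l) (W s * \prod_(t <- l | t != s) d t + w s u * W s * D).
  apply: eq_big_seq => s sl; have us : u != s by rewrite eq_sym neu.
  rewrite !big_cons us -/(W s) -/(w s u) -/(d u).
  have -> : D = d s * \prod_(t <- l | t != s) d t.
    by rewrite /D (@prodr_pull _ _ xpredT _ s) // => t tl; apply: pcommC; apply: hd.
  have hws : pcomm (w s u) by apply: w_comm; rewrite ?inE ?sl ?eqxx ?orbT // eq_sym.
  have hdu : pcomm (d u) by apply: commutantB => //; apply: pcomm_p.
  have du : w s u * d u = 1 + w s u * d s.
    have [_ h] := ginvP (li _ sl) ui (neu _ sl).
    by rewrite -h -mulrDr /d; congr (_ * _); rewrite [RHS]addrC addrA subrK.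
  rewrite mulrA -[w s u * _ * _]mulrA (pcommC (hW _ sl) hdu) mulrA du.
  rewrite mulrDl mul1r mulrDl -!mulrA; congr (_ + _); congr (_ * _).
  by rewrite !mulrA (pcommC (hW _ sl) (hd _ sl)).
rewrite big_split /= IH // -mulr_suml.
by rewrite hA mulNr addrCA addNr addr0.
Qed.

Lemma sum_iP'_P' i y : (0 < a i)%N -> pcomm y ->
  \sum_(s <- iota 1 (a i)) iP' i s * P' i s y = 1.
Proof.
move=> ai hy; apply: lagrange => //; first exact: iota_uniq.
by rewrite -size_eq0 size_iota -lt0n.
Qed.

Section WithZ.
Variables (z : B) (h0 h1 : nat -> nat -> B) (S : B -> Prop).
Hypothesis z_comm : forall x, z * x = x * z.
Hypothesis h0P : forall i s, s \rng i ->
  (z - p i s) * h0 i s = 1 /\ h0 i s * (z - p i s) = 1.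
Hypothesis h1P : forall i s, s \rng i ->
  (z - (p i s + 1)) * h1 i s = 1 /\ h1 i s * (z - (p i s + 1)) = 1.
Hypothesis S1 : S 1.
Hypothesis SB : forall x y, S x -> S y -> S (x - y).
Hypothesis SM : forall x y, S x -> S y -> S (x * y).
Hypothesis Sz : S z.
Hypothesis Sp : forall i s, s \rng i -> S (p i s).
Hypothesis Sq : forall i s, s \rng i -> S (gq G i s).
Hypothesis Sqi : forall i s, s \rng i -> S (gqi G i s).
Hypothesis Sginv : forall i s t, s \rng i -> t \rng i -> s != t -> S (ginv G i s t 0).

Lemma closed0 : S 0. Proof. by rewrite -(subrr 1); apply: SB. Qed.
Lemma closedN x : S x -> S (- x). Proof. by rewrite -sub0r; apply: SB; exact: closed0. Qed.
Lemma closedD x y : S x -> S y -> S (x + y).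
Proof. by move=> hx hy; rewrite -[y]opprK; apply: SB => //; apply: closedN. Qed.
Lemma closed_sum (l : seq nat) (Q : pred nat) (F : nat -> B) :
  (forall s, s \in l -> Q s -> S (F s)) -> S (\sum_(s <- l | Q s) F s).
Proof.
move=> h; rewrite big_seq_cond; elim/big_rec: _ => [|s x /andP[sl Qs]]; first exact: closed0.
by apply: closedD; apply: h.
Qed.
Lemma closed_prod (l : seq nat) (Q : pred nat) (F : nat -> B) :
  (forall s, s \in l -> Q s -> S (F s)) -> S (\prod_(s <- l | Q s) F s).
Proof.
by move=> h; rewrite big_seq_cond; elim/big_rec: _ => [//|s x /andP[sl Qs]]; apply: SM; apply: h.
Qed.

Lemma closed_P i x : S x -> S (P i x).
Proof. by move=> Sx; apply: closed_prod => s si _; apply: SB; auto. Qed.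
Lemma closed_P' i t x : S x -> S (P' i t x).
Proof. by move=> Sx; apply: closed_prod => s si _; apply: SB; auto. Qed.
Lemma closed_iP' i t : t \rng i -> S (iP' i t).
Proof. by move=> ti; apply: closed_prod => s si st; apply: Sginv => //; rewrite eq_sym. Qed.

Lemma pcomm_z : pcomm z. Proof. by move=> y _; rewrite /GRing.comm z_comm. Qed.

Lemma pcomm_h0 i s : s \rng i -> pcomm (h0 i s).
Proof.
by move=> si; case: (h0P si) => u v; apply: commutantV u v _; apply: commutantB pcomm_z (pcomm_p si).
Qed.

Lemma pcomm_h1 i s : s \rng i -> pcomm (h1 i s).
Proof.
by move=> si; case: (h1P si) => u v; apply: commutantV u v _; apply: commutantB pcomm_z (pcomm_p1 si).
Qed.

Lemma prod_h1_P' i s : s \rng i -> \prod_(t <- iota 1 (a i)) h1 i t * P' i s (z - 1) = h1 i s.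
Proof.
set W := \prod_(t <- _) _; have hy : pcomm (z - 1) by apply: commutantB pcomm_z pcomm1.
have hyp t : t \rng i -> (z - 1 - p i t) * h1 i t = 1 /\ h1 i t * (z - 1 - p i t) = 1.
  by move=> ti; have := h1P ti; rewrite opprD addrA addrAC.
have WP : W * P i (z - 1) = 1.
  rewrite /W -prodrM_comm_seq => [|t u ti ui]; last first.
    by apply: pcommC; [apply: pcomm_h1|apply: commutantB hy (pcomm_p ui)].
  by rewrite big_seq big1 // => t ti; have [] := hyp t ti.
move=> si; have [u1 u2] := hyp s si.
transitivity (W * P i (z - 1) * h1 i s); last by rewrite WP mul1r.
have c : GRing.comm (z - 1 - p i s) (P' i s (z - 1)).
  exact: pcommC (commutantB hy (pcomm_p si)) (pcomm_P' i s hy).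
by rewrite (P_pull si hy) c -!mulrA u1 mulr1.
Qed.

Lemma prod_h1E i : (0 < a i)%N ->
  \prod_(s <- iota 1 (a i)) h1 i s = \sum_(s <- iota 1 (a i)) h1 i s * iP' i s.
Proof.
move=> a_gt0; have hy : pcomm (z - 1) by apply: commutantB pcomm_z pcomm1.
set W := \prod_(s <- _) _; rewrite -[LHS]mulr1 -(sum_iP'_P' a_gt0 hy) mulr_sumr.
apply: eq_big_seq => s si; rewrite -(prod_h1_P' si) -/W -mulrA; congr (_ * _).
exact: pcommC (pcomm_iP' si) (pcomm_P' i s hy).
Qed.

(* The partial fraction expansion in z of P_i(x) / (P_i(z-1) (z-1-x)). *)
Lemma partial_fractions i x v : pcomm x -> pcomm v -> v * (z - 1 - x) = 1 ->
  \prod_(s <- iota 1 (a i)) h1 i s * (v * P i x) =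
  v - \sum_(s <- iota 1 (a i)) h1 i s * iP' i s * P' i s x.
Proof.
move=> hx hv vx; case: (posnP (a i)) => [a0|a_gt0].
  by rewrite /Pev a0 !big_nil mul1r mulr1 subr0.
rewrite (prod_h1E a_gt0) mulr_suml.
rewrite -[X in X - _]mulr1 -(sum_iP'_P' a_gt0 hx) mulr_sumr -sumrB.
apply: eq_big_seq => s si.
have [u1 u2] : (z - 1 - p i s) * h1 i s = 1 /\ h1 i s * (z - 1 - p i s) = 1.
  by have := h1P si; rewrite opprD addrA addrAC.
have hi := pcomm_iP' si; have h'x := pcomm_P' i s hx; have hh := pcomm_h1 si.
have key : h1 i s * (v * (x - p i s)) = v - h1 i s.
  have -> : x - p i s = (z - 1 - p i s) - (z - 1 - x) by rewrite opprB [RHS]addrC addrA subrK.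
  rewrite mulrBr mulrBr vx mulr1; congr (_ - _).
  by rewrite mulrA (pcommC hh hv) -mulrA u2 mulr1.
rewrite (pcommC hh hi) (P_pull si hx) [v * _]mulrA -mulrA [h1 i s * (_ * _)]mulrA key.
by rewrite mulrBl mulrBr; congr (_ - _); rewrite !mulrA ?(pcommC hi hv).
Qed.

Lemma divided_difference (l : seq nat) (Q : pred nat) i x :
  {subset l <= iota 1 (a i)} -> S x -> pcomm x ->
  exists2 q, S q & \prod_(s <- l | Q s) (z - p i s) - \prod_(s <- l | Q s) (x - p i s) = (z - x) * q.
Proof.
move=> + Sx hx; elim: l => [|s l IH] li.
  by exists 0; [exact: closed0|rewrite !big_nil subrr mulr0].
have si : s \rng i by apply: li; rewrite inE eqxx.
have {}li : {subset l <= iota 1 (a i)} by move=> t tl; apply: li; rewrite inE tl orbT.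
have [q Sq' qE] := IH li; rewrite !big_cons; case: (Q s); last by exists q.
exists ((z - p i s) * q + \prod_(s <- l | Q s) (x - p i s)).
  apply: closedD; first by apply: SM => //; apply: SB; auto.
  by apply: closed_prod => t tl _; apply: SB; auto.
have c : GRing.comm (z - x) (z - p i s).
  exact: pcommC (commutantB pcomm_z hx) (commutantB pcomm_z (pcomm_p si)).
rewrite mulrDr mulrA c -mulrA -qE.
rewrite mulrBr -addrA; congr (_ + _); rewrite -!mulNr -mulrDl; congr (_ * _).
by rewrite !opprB addrA subrK.
Qed.

(* With alpha = i + l, [PHI l i z] is f_{alpha i}(z) P_i(z) and [phi l i s] is
   the residue of f_{alpha i} at z = p_{i,s} + 1; the recursion on [l] is the sum
   over the tuples (r_i, ..., r_{alpha-1}), taken one index at a time. *)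
Fixpoint PHI (l i : nat) (x : B) : B :=
  if l is l'.+1 then
    \sum_(s <- iota 1 (a i)) P' i s x * (PHI l' i.+1 (p i s + 1) * iP' i s * gqi G i s)
  else P i x.

(* [phi] and [chi] are locked to keep associativity rewriting out of them. *)
Definition phi l i s := locked (PHI l i.+1 (p i s + 1) * iP' i s * gqi G i s).
Lemma phiE l i s : phi l i s = PHI l i.+1 (p i s + 1) * iP' i s * gqi G i s.
Proof. by rewrite /phi -lock. Qed.

(* With beta = i + l, e_{i beta}(z) is the sum over t of
   P_{i-1}(p_{i,t} - 1) / (z - p_{i,t}) * [chi l i t], where
   [chi l i t] carries the sum over the remaining indices. *)
Fixpoint SIG (l i s : nat) : B :=
  if l is l'.+1 then
    \sum_(t <- iota 1 (a i)) P' i.-1 s (p i t - 1) * (iP' i t * gq G i t * SIG l' i.+1 t)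
  else -1.

Definition chi l i t := locked (iP' i t * gq G i t * SIG l i.+1 t).
Lemma chiE l i t : chi l i t = iP' i t * gq G i t * SIG l i.+1 t.
Proof. by rewrite /chi -lock. Qed.

Lemma PHI_phi l i x : PHI l.+1 i x = \sum_(s <- iota 1 (a i)) P' i s x * phi l i s.
Proof. by apply: eq_bigr => s _; rewrite phiE. Qed.

Lemma SIG_chi l i s :
  SIG l.+1 i s = \sum_(t <- iota 1 (a i)) P' i.-1 s (p i t - 1) * chi l i t.
Proof. by apply: eq_bigr => t _; rewrite chiE. Qed.

Lemma commutant_PHI Y l i x : commutant Y x ->
  (forall j s, (i <= j)%N -> s \rng j -> commutant Y (p j s) /\ commutant Y (gqi G j s)) ->
  commutant Y (PHI l i x).
Proof.
elim: l i x => [|l IH] i x hx hY /=.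
  by apply: commutant_P => // s si; have [] := hY _ _ (leqnn i) si.
have hp s : s \rng i -> commutant Y (p i s) by move=> si; have [] := hY _ _ (leqnn i) si.
apply: commutant_sum => s si _; apply: commutantM; first by apply: commutant_P'; auto.
apply: commutantM; last by have [] := hY _ _ (leqnn i) si.
apply: commutantM; last by apply: commutant_iP'; auto.
apply: IH => [|j t ij tj]; last by apply: hY => //; apply: ltnW.
by apply: commutantD (hp _ si) (@commutant1 _ _).
Qed.

Lemma PHI_comm_p l i x s : s \rng i -> pcomm x -> GRing.comm (p i s) (PHI l i.+1 x).
Proof.
move=> si hx; apply: (@commutant_PHI (eq (p i s))) => // [y <-|j t ij tj].
  exact: pcommC (pcomm_p si) hx.
split=> y <-; first exact: pp_comm.
by apply/commr_sym/qip_comm => //; rewrite xpair_eqE gtn_eqF.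
Qed.

Lemma closed_PHI l i x : S x -> S (PHI l i x).
Proof.
elim: l i x => [|l IH] i x Sx /=; first exact: closed_P.
apply: closed_sum => s si _; apply: SM; first exact: closed_P'.
apply: SM; last exact: Sqi.
by apply: SM (closed_iP' si); apply: IH; apply: closedD S1; apply: Sp.
Qed.

Lemma closed_phi l i s : s \rng i -> S (phi l i s).
Proof.
move=> si; rewrite phiE; apply: SM; last exact: Sqi.
by apply: SM (closed_iP' si); apply: closed_PHI; apply: closedD S1; apply: Sp.
Qed.

Lemma closed_SIG l i s : S (SIG l i s).
Proof.
elim: l i s => [|l IH] i s /=; first exact: closedN.
apply: closed_sum => t ti _; apply: SM; first by apply: closed_P'; apply: SB S1; apply: Sp.
by apply: SM => //; apply: SM; [exact: closed_iP'|exact: Sq].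
Qed.

Lemma closed_chi l i s : s \rng i -> S (chi l i s).
Proof. by move=> si; rewrite chiE; apply: SM (closed_SIG _ _ _); apply: SM; [exact: closed_iP'|exact: Sq]. Qed.

Lemma phi_comm l i s t : s \rng i -> t \rng i -> s != t -> GRing.comm (p i t) (phi l i s).
Proof.
move=> si ti st; rewrite phiE; apply: commrM; last first.
  by apply/commr_sym/qip_comm => //; rewrite xpair_eqE negb_and st orbT.
apply: commrM; first exact: PHI_comm_p (pcomm_p1 si).
exact: pcommC (pcomm_p ti) (pcomm_iP' si).
Qed.

Lemma phi_shift l i s : s \rng i -> phi l i s * (z - p i s) = (z - (p i s + 1)) * phi l i s.
Proof.
move=> si; rewrite mulrBr mulrBl z_comm; congr (_ - _).
rewrite phiE -[LHS]mulrA qip_shift // [RHS]mulrA; rewrite [LHS]mulrA; congr (_ * _).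
have c : GRing.comm (p i s + 1) (PHI l i.+1 (p i s + 1) * iP' i s).
  apply/commr_sym/commrD; last exact: commr1.
  apply/commr_sym; apply: commrM; first exact: PHI_comm_p (pcomm_p1 si).
  exact: pcommC (pcomm_p si) (pcomm_iP' si).
by rewrite -c.
Qed.

Lemma phi_h0_same l i s : s \rng i -> phi l i s * h0 i s = h1 i s * phi l i s.
Proof.
move=> si; have [u1 u2] := h0P si; have [v1 v2] := h1P si.
by rewrite -[LHS]mul1r -v2 -mulrA [_ * (_ * h0 _ _)]mulrA -phi_shift // -mulrA u1 mulr1.
Qed.

Lemma phi_h0_neq l i s t : s \rng i -> t \rng i -> s != t ->
  phi l i s * h0 i t = h0 i t * phi l i s.
Proof.
move=> si ti st; have [u1 u2] := h0P ti; apply: comm_inv u1 u2 _.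
apply: commrB; first by rewrite /GRing.comm z_comm.
exact/commr_sym/phi_comm.
Qed.

Lemma comm_phi_P' l i s x : s \rng i -> GRing.comm x (phi l i s) ->
  GRing.comm (phi l i s) (P' i s x).
Proof.
move=> si cx; apply: (@commutant_P' (eq (phi l i s)) i s x) => // [y <-|t ti ts y <-].
  exact: commr_sym.
by apply/commr_sym/phi_comm => //; rewrite eq_sym.
Qed.

Definition fser l i := if l is l'.+1 then \sum_(s <- iota 1 (a i)) h1 i s * phi l' i s else 1.
Definition eser l i :=
  if l is l'.+1 then \sum_(t <- iota 1 (a i)) h0 i t * P i.-1 (p i t - 1) * chi l' i t else 1.
Definition epolar l i := if l is l'.+1 then \sum_(t <- iota 1 (a i)) h0 i t * chi l' i t else 0.

Lemma fser_mul_P l i : fser l i * P i z = PHI l i z.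
Proof.
case: l => [|l]; first by rewrite mul1r.
rewrite PHI_phi mulr_suml; apply: eq_big_seq => s si.
rewrite (P_pull si pcomm_z) -!mulrA [phi _ _ _ * _]mulrA phi_shift //.
rewrite !mulrA; have [_ ->] := h1P si; rewrite mul1r.
by rewrite comm_phi_P' // /GRing.comm z_comm.
Qed.

Lemma eser_split l i : (0 < i)%N -> (0 < l)%N || (0 < a i.-1)%N ->
  \prod_(s <- iota 1 (a i.-1)) h1 i.-1 s * eser l i =
  epolar l i - \sum_(s <- iota 1 (a i.-1)) h1 i.-1 s * iP' i.-1 s * SIG l i s.
Proof.
move=> i_gt0; case: l => [|l] hl.
  rewrite [LHS]mulr1 (prod_h1E hl) [RHS]sub0r -sumrN.
  by apply: eq_bigr => s _; rewrite mulrN1 opprK.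
rewrite mulr_sumr.
rewrite (eq_big_seq (fun t => h0 i t * chi l i t -
    (\sum_(s <- iota 1 (a i.-1)) h1 i.-1 s * iP' i.-1 s * P' i.-1 s (p i t - 1)) * chi l i t)).
  rewrite sumrB; congr (_ - _).
  rewrite (eq_bigr _ (fun t _ => mulr_suml _ _ _ _)) exchange_big.
  by apply: eq_bigr => s _; rewrite SIG_chi mulr_sumr; apply: eq_bigr => t _; rewrite mulrA.
move=> t ti; rewrite mulrA partial_fractions ?mulrBl //.
- exact: commutantB (pcomm_p ti) pcomm1.
- exact: pcomm_h0.
- by rewrite opprB addrA subrK; have [] := h0P ti.
Qed.

Lemma mulz_h1 x i s : s \rng i -> h1 i s * ((z - (p i s + 1)) * x) = x.
Proof. by move=> si; have [_ h] := h1P si; rewrite mulrA h mul1r. Qed.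

Lemma closed_h1_P' i s : s \rng i -> S (h1 i s * (P' i s z - P' i s (p i s + 1))).
Proof.
move=> si; have Sp1 := closedD (Sp si) S1.
have [q Sq' qE] := @divided_difference (iota 1 (a i)) (predC1 s) i _ (fun _ => id) Sp1 (pcomm_p1 si).
by rewrite /Pev' qE mulz_h1.
Qed.

Lemma closed_h1_PHI l i s : s \rng i ->
  S (h1 i s * (PHI l i.+1 z - PHI l i.+1 (p i s + 1))).
Proof.
move=> si; have Sp1 := closedD (Sp si) S1; case: l => [|l]; rewrite ?PHI_phi /=.
  have [q Sq' qE] := @divided_difference _ xpredT i.+1 _ (fun _ => id) Sp1 (pcomm_p1 si).
  by rewrite /Pev qE mulz_h1.
rewrite -sumrB mulr_sumr; apply: closed_sum => t ti _; rewrite -mulrBl mulrA.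
apply: SM; last exact: closed_phi.
have [q Sq' qE] := @divided_difference (iota 1 (a i.+1)) (predC1 t) i.+1 _ (fun _ => id) Sp1 (pcomm_p1 si).
by rewrite /Pev' qE mulz_h1.
Qed.

Lemma qi_P' i s : s \rng i -> P' i s (p i s + 1) * gqi G i s = gqi G i s * P' i s (p i s).
Proof.
move=> si; rewrite /Pev'; have : {subset iota 1 (a i) <= iota 1 (a i)} by [].
elim: {1 3 4}(iota 1 (a i)) => [|t l IH] li; first by rewrite !big_nil mul1r mulr1.
have ti : t \rng i by apply: li; rewrite inE eqxx.
have {}IH := IH (fun u ul => li u (mem_behead (s := t :: l) ul)).
rewrite !big_cons; case: eqVneq => //= ts; rewrite -mulrA IH !mulrA; congr (_ * _).
rewrite mulrBl mulrBr qip_shift //; congr (_ - _).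
by apply/commr_sym/qip_comm; rewrite // xpair_eqE eqxx eq_sym.
Qed.

Lemma phi_chi l k i s : s \rng i ->
  P' i s (p i s + 1) * (phi l i s * chi k i s) = PHI l i.+1 (p i s + 1) * (iP' i s * SIG k i.+1 s).
Proof.
move=> si; rewrite phiE chiE; set F := PHI _ _ _; set D := P' i s _.
have cF : GRing.comm D F.
  apply/commr_sym; apply: (@commutant_P' (eq F)) => // [y <-|t ti _ y <-].
    by apply: commrD; [apply/commr_sym/PHI_comm_p/pcomm_p1|exact: commr1].
  exact/commr_sym/PHI_comm_p/pcomm_p1.
have ci := pcommC (pcomm_P' i s (pcomm_p1 si)) (pcomm_iP' si).
rewrite !mulrA cF -(mulrA F) ci -!mulrA; congr (_ * (_ * _)).
rewrite [D * _]mulrA qi_P' // -!mulrA [P' _ _ _ * _]mulrA mul_P'_iP' // mul1r.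
by rewrite mulrA qiq // mul1r.
Qed.

(* The pole parts at z = p_{i,s} + 1 of the summands i and i + 1. *)
Lemma residues_cancel l k i :
  S (PHI l.+1 i z * epolar k.+1 i -
     PHI l i.+1 z * \sum_(s <- iota 1 (a i)) h1 i s * iP' i s * SIG k i.+1 s).
Proof.
rewrite PHI_phi /= mulr_suml mulr_sumr -sumrB; apply: closed_sum => s si _.
rewrite (bigD1_seq s) ?iota_uniq //= mulrDr addrAC; apply: closedD; last first.
  rewrite mulr_sumr; apply: closed_sum => t ti ts.
  have st : s != t by rewrite eq_sym.
  rewrite -!mulrA [phi _ _ _ * _]mulrA phi_h0_neq // !mulrA.
  apply: SM (closed_chi k ti); apply: SM (closed_phi l si).
  have cc u v : u \rng i -> v \rng i -> GRing.comm (z - p i u) (z - p i v).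
    by move=> ui vi; exact: pcommC (commutantB pcomm_z (pcomm_p ui)) (commutantB pcomm_z (pcomm_p vi)).
  rewrite /Pev' (@prodr_pull _ _ (predC1 s) _ t) ?iota_uniq // => [|u ui]; last exact: cc.
  set R := \prod_(u <- _ | _) _.
  have hR : GRing.comm R (z - p i t).
    by apply/commr_sym; rewrite /R big_seq_cond; apply: commr_prod => u /andP[ui _]; apply: cc.
  rewrite -hR -mulrA; have [-> _] := h0P ti; rewrite mulr1.
  by apply: closed_prod => u ui _; apply: SB; auto.
have hh := pcomm_h1 si; have hz' := pcomm_P' i s pcomm_z.
rewrite -mulrA [phi _ _ _ * _]mulrA phi_h0_same // !mulrA (pcommC hz' hh).
have cP : GRing.comm (PHI l i.+1 z) (h1 i s).
  have [u v] := h1P si; apply: comm_inv u v _; apply: commrB; first by rewrite /GRing.comm z_comm.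
  by apply: commrD; [apply/commr_sym/PHI_comm_p/pcomm_z|exact: commr1].
rewrite cP -[_ * chi _ _ _]mulrA -[h1 i s * _ * iP' _ _ * _]mulrA.
have -> : h1 i s * P' i s z * (phi l i s * chi k i s) - h1 i s * PHI l i.+1 z * (iP' i s * SIG k i.+1 s)
  = h1 i s * (P' i s z - P' i s (p i s + 1)) * (phi l i s * chi k i s) -
    h1 i s * (PHI l i.+1 z - PHI l i.+1 (p i s + 1)) * (iP' i s * SIG k i.+1 s).
  by rewrite !mulrBr !mulrBl -[h1 i s * P' i s (_ + 1) * _]mulrA phi_chi // !mulrA opprB addrA subrK.
apply: SB; apply: SM.
- exact: closed_h1_P'.
- by apply: SM; [exact: closed_phi|exact: closed_chi].
- exact: closed_h1_PHI.
- by apply: SM; [exact: closed_iP'|exact: closed_SIG].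
Qed.

Lemma closed_PHI_epolar l k i : (l == 0)%N || (k == 0)%N -> S (PHI l i z * epolar k i).
Proof.
case: k => [|k]; first by rewrite mulr0 => _; exact: closed0.
rewrite orbF => /eqP->; rewrite mulr_sumr; apply: closed_sum => t ti _.
have hP := pcomm_P' i t pcomm_z; have [u _] := h0P ti.
rewrite /= mulrA (P_pull ti pcomm_z) -[_ * h0 i t]mulrA (pcommC hP (pcomm_h0 ti)) mulrA u mul1r.
by apply: SM (closed_chi k ti); exact: closed_P'.
Qed.

Theorem T_regular m l k : (0 < m)%N -> (m <= 2 * r)%N -> (l == 0)%N || (k == 0)%N ->
  S (\sum_(i <- iota 1 m)
       fser (m + l - i) i * (P i z * \prod_(s <- iota 1 (a i.-1)) h1 i.-1 s * eser (m + k - i) i)).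
Proof.
move=> m_gt0 mr lk.
pose T i := fser (m + l - i) i * (P i z * \prod_(s <- iota 1 (a i.-1)) h1 i.-1 s * eser (m + k - i) i).
rewrite -/(\sum_(i <- iota 1 m) T i).
have a0 : a 0 = 0%N by rewrite /acoef min0n.
have TE i : T i = PHI (m + l - i) i z * (\prod_(s <- iota 1 (a i.-1)) h1 i.-1 s * eser (m + k - i) i).
  by rewrite /T -!mulrA mulrA fser_mul_P.
case: (boolP ((m == 1%N) && (k == 0%N))) => [/andP[/eqP m1 /eqP k0]|mk].
  by rewrite m1 big_seq1 TE m1 k0 a0 big_nil !mulr1; apply: closed_PHI.
pose U i := PHI (m + l - i) i z * epolar (m + k - i) i.
have TU i : (0 < i)%N -> (i <= m)%N -> T i = U i - PHI (m + l - i) i z *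
    \sum_(s <- iota 1 (a i.-1)) h1 i.-1 s * iP' i.-1 s * SIG (m + k - i) i s.
  by move=> i0 im; rewrite TE eser_split ?mulrBr //; move: mk i0 im mr; rewrite /acoef; lia.
suff main j : (0 < j)%N -> (j <= m)%N -> S (\sum_(i <- iota 1 j) T i - U j).
  rewrite -[X in S X](subrK (U m)); apply: closedD; first exact: main.
  by apply: closed_PHI_epolar; rewrite !addKn.
elim: j => // j IH _ jm; case: (posnP j) => [->|j_gt0].
  rewrite big_seq1 TU // a0 big_nil mulr0 subr0 subrr; exact: closed0.
have -> : iota 1 j.+1 = iota 1 j ++ [:: j.+1] by rewrite -[X in iota 1 X]addn1 iotaD.
rewrite big_cat big_seq1 [X in X - _](_ : _ = \sum_(i <- iota 1 j) T i + T j.+1) // TU //.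
rewrite [U _ - _]addrC [_ + (_ + U _)]addrA addrK -[\sum_(i <- _) _](subrK (U j)) -addrA.
apply: closedD; first by apply: IH => //; apply: ltnW.
rewrite /U; have -> : (m + l - j)%N = (m + l - j.+1).+1 by lia.
have -> : (m + k - j)%N = (m + k - j.+1).+1 by lia.
exact: residues_cancel.
Qed.

End WithZ.

Lemma mem_tuples i l t k : t \in tuples a i l -> (k < l)%N -> nth 0%N t k \rng (i + k)%N.
Proof.
elim: l i t k => // l IH i t k /allpairsPdep[x [u [xi ul ->]]].
by case: k => [|k] kl; rewrite ?addn0 // addnS -addSn; apply: IH.
Qed.

Lemma sum_tuplesS i l (F : seq nat -> B) :
  \sum_(t <- tuples a i l.+1) F t =
  \sum_(x <- iota 1 (a i)) \sum_(t <- tuples a i.+1 l) F (x :: t).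
Proof. by rewrite /= big_allpairs_dep. Qed.

Definition fcoef j i rs : B := let R := rk i rs in
  P j (p j.-1 (R j.-1) + 1) *
  \prod_(k <- iota i.+1 (j.-1 - i)) P' k (R k) (p k.-1 (R k.-1) + 1) *
  \prod_(k <- iota i (j - i)) iP' k (R k) * \prod_(k <- iota i (j - i)) gqi G k (R k).

Definition ecoef j i rs : B := let R := rk i rs in
  \prod_(k <- iota i (j.-1 - i)) P' k (R k) (p k.+1 (R k.+1) - 1) *
  \prod_(k <- iota i (j - i)) iP' k (R k) * \prod_(k <- iota i (j - i)) gq G k (R k).

Lemma rk_cons i s t k : (i < k)%N -> rk i (s :: t) k = rk i.+1 t k.
Proof. by move=> ik; rewrite /rk -(subnSK ik). Qed.

Lemma rk0 i s t : rk i (s :: t) i = s. Proof. by rewrite /rk subnn. Qed.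

Lemma rk_rng i l rs k : rs \in tuples a i l -> (i <= k < i + l)%N -> rk i rs k \rng k.
Proof.
move=> rsT /andP[ik kl]; rewrite -{2}(subnKC ik); apply: mem_tuples rsT _; lia.
Qed.

Lemma commutant_q Y i s l rs : s \rng i -> rs \in tuples a i.+1 l ->
  Y = eq (gq G i s) \/ Y = eq (gqi G i s) ->
  [/\ forall k t, (i < k)%N -> t \rng k -> commutant Y (p k t),
      commutant Y (\prod_(k <- iota i.+1 l) iP' k (rk i.+1 rs k)) &
      commutant Y 1].
Proof.
move=> si rsT hY.
have hp k t : (i < k)%N -> t \rng k -> commutant Y (p k t).
  by case: hY => -> ik tk y <-; [apply: qp_comm|apply: qip_comm]; rewrite // xpair_eqE ltn_eqF.
split=> //; last exact: commutant1.
apply: commutant_prod => k; rewrite mem_iota => /andP[ik kl] _.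
by apply: commutant_iP' => [|t tk]; [apply: rk_rng rsT _; lia|apply: hp].
Qed.

Lemma fcoef_cons l i s x t : s \rng i -> x :: t \in tuples a i.+1 l.+1 ->
  fcoef (i + l.+2) i (s :: x :: t) =
  P' i.+1 x (p i s + 1) * iP' i s * gqi G i s * fcoef (i.+1 + l.+1) i.+1 (x :: t).
Proof.
move=> si rsT; have [hp hD h1] := commutant_q si rsT (or_intror erefl).
have hR k : (i.+1 <= k < i.+1 + l.+1)%N -> rk i.+1 (x :: t) k \rng k by apply: rk_rng rsT.
have xi : x \rng i.+1 by rewrite -(rk0 i.+1 x t); apply: hR; lia.
rewrite /fcoef.
have -> : ((i + l.+2).-1 - i = l.+1)%N by lia.
have -> : (i + l.+2 - i = l.+2)%N by lia.
have -> : ((i.+1 + l.+1).-1 - i.+1 = l)%N by lia.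
have -> : (i.+1 + l.+1 - i.+1 = l.+1)%N by lia.
have jE : (i + l.+2 = i.+1 + l.+1)%N by lia.
have rkE k : (i < k)%N -> rk i (s :: x :: t) k = rk i.+1 (x :: t) k by apply: rk_cons.
have eR (F : nat -> nat -> B) : \prod_(k <- iota i l.+2) F k (rk i (s :: x :: t) k) =
    F i s * \prod_(k <- iota i.+1 l.+1) F k (rk i.+1 (x :: t) k).
  rewrite -[iota i l.+2]/(i :: iota i.+1 l.+1) big_cons rk0; congr (_ * _).
  by apply: eq_big_seq => k; rewrite mem_iota => kl; rewrite rkE //; lia.
rewrite !eR jE rkE; last by lia.
rewrite -[iota i.+1 l.+1 in X in _ * X * _ * _ = _]/(i.+1 :: iota i.+2 l) big_cons rkE // !rk0.
set R := rk i.+1 (x :: t); set N := \prod_(k <- iota i.+2 l) P' k (R k) _.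
rewrite (eq_big_seq (fun k => P' k (R k) (p k.-1 (R k.-1) + 1))) -/N; last first.
  by move=> k; rewrite mem_iota => kl; rewrite !rkE //; lia.
set D := \prod_(k <- iota i.+1 l.+1) iP' k (R k).
set E := \prod_(k <- iota i.+1 l.+1) gqi G k (R k).
have hN : pcomm N.
  apply: commutant_prod => k; rewrite mem_iota => kl _; apply: pcomm_P'.
  by apply: pcomm_p1; apply: hR; lia.
set Pj := P _ _; have hPj : pcomm Pj by apply: pcomm_P; apply: pcomm_p1; apply: hR; lia.
have qN : commutant (eq (gqi G i s)) N.
  apply: commutant_prod => k; rewrite mem_iota => kl _.
  apply: commutant_P' => [|u uk _]; last by apply: hp => //; lia.
  by apply: commutantD h1; apply: hp; [lia|apply: hR; lia].
have qPj : commutant (eq (gqi G i s)) Pj.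
  apply: commutant_P => [|u uk]; last by apply: hp => //; lia.
  by apply: commutantD h1; apply: hp; [lia|apply: hR; lia].
set X := P' i.+1 x _; have hX : pcomm X by apply/pcomm_P'/pcomm_p1.
have qX := commutantM (commutantM qPj qN) hD.
rewrite -/D in qX; rewrite -/X -[RHS]mulrA [in RHS](mulrA (gqi G i s)) qX // !mulrA.
rewrite (pcommC hPj hX) -[X * iP' i s * Pj * N]mulrA -(mulrA X Pj).
by rewrite -[X * iP' i s * _]mulrA (pcommC (pcomm_iP' si) (commutantM hPj hN)) [in RHS]mulrA.
Qed.

Lemma pcomm_fnum l i rs : rs \in tuples a i l.+1 -> let R := rk i rs in
  let j := (i + l.+1)%N in
  pcomm (P j (p j.-1 (R j.-1) + 1) *
    \prod_(k <- iota i.+1 (j.-1 - i)) P' k (R k) (p k.-1 (R k.-1) + 1) *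
    \prod_(k <- iota i (j - i)) iP' k (R k)).
Proof.
move=> rsT /=; have hR k : (i <= k < i + l.+1)%N -> rk i rs k \rng k by apply: rk_rng rsT.
apply: commutantM; first apply: commutantM.
- by apply/pcomm_P/pcomm_p1/hR; lia.
- apply: commutant_prod => k; rewrite mem_iota => kl _.
  by apply/pcomm_P'/pcomm_p1/hR; lia.
- by apply: commutant_prod => k; rewrite mem_iota => kl _; apply/pcomm_iP'/hR; lia.
Qed.

Lemma pcomm_enum l i rs : rs \in tuples a i l.+1 -> let R := rk i rs in
  let j := (i + l.+1)%N in
  pcomm (P i.-1 (p i (R i) - 1) *
    \prod_(k <- iota i (j.-1 - i)) P' k (R k) (p k.+1 (R k.+1) - 1) *
    \prod_(k <- iota i (j - i)) iP' k (R k)).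
Proof.
move=> rsT /=; have hR k : (i <= k < i + l.+1)%N -> rk i rs k \rng k by apply: rk_rng rsT.
have hp k : (i <= k < i + l.+1)%N -> pcomm (p k (rk i rs k) - 1).
  by move=> kl; apply: commutantB (pcomm_p (hR _ kl)) pcomm1.
apply: commutantM; first apply: commutantM.
- by apply/pcomm_P/hp; lia.
- by apply: commutant_prod => k; rewrite mem_iota => kl _; apply/pcomm_P'/hp; lia.
- by apply: commutant_prod => k; rewrite mem_iota => kl _; apply/pcomm_iP'/hR; lia.
Qed.

Lemma commutant_phi Y l i s : s \rng i ->
  (forall j t, (i <= j)%N -> t \rng j -> commutant Y (p j t) /\ commutant Y (gqi G j t)) ->
  commutant Y (phi l i s).
Proof.
move=> si hY; rewrite phiE; have [hp hq] := hY _ _ (leqnn i) si.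
apply: commutantM => //; apply: commutantM.
  apply: commutant_PHI => [|j t ij tj]; first by apply: commutantD hp (@commutant1 _ _).
  by apply: hY => //; apply: ltnW.
by apply: commutant_iP' => // t ti; have [] := hY _ _ (leqnn i) ti.
Qed.

Lemma sum_fcoef l i s : s \rng i ->
  \sum_(t <- tuples a i.+1 l) fcoef (i + l.+1) i (s :: t) = phi l i s.
Proof.
elim: l i s => [|l IH] i s si.
  rewrite phiE big_seq1 /fcoef addn1 /= subnn subSnn /= !big_seq1 big_nil mulr1.
  by rewrite !rk0.
rewrite sum_tuplesS [RHS]phiE PHI_phi !mulr_suml; apply: eq_big_seq => x xi.
rewrite (eq_big_seq (fun t => P' i.+1 x (p i s + 1) * iP' i s * gqi G i s *
   fcoef (i.+1 + l.+1) i.+1 (x :: t))); last first.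
  move=> t tl; apply: fcoef_cons => //; apply/allpairsPdep.
  by exists x, t.
rewrite -mulr_sumr IH // -!mulrA; congr (_ * _).
have ci : GRing.comm (gqi G i s) (phi l i.+1 x).
  apply: (@commutant_phi (eq (gqi G i s))) => // j t ij tj.
  split=> y <-; last exact: qi_comm.
  by apply: qip_comm => //; rewrite xpair_eqE ltn_eqF.
have cp : GRing.comm (iP' i s) (phi l i.+1 x).
  apply/commr_sym; apply: (@commutant_iP' (eq (phi l i.+1 x))) => // u ui y <-.
  apply/commr_sym; apply: (@commutant_phi (eq (p i u))) => // j t ij tj.
  split=> y' <-; first exact: pp_comm.
  by apply/commr_sym/qip_comm => //; rewrite xpair_eqE gtn_eqF.
by rewrite ci !mulrA cp.
Qed.

Lemma ecoef_cons l i s x t : s \rng i -> x :: t \in tuples a i.+1 l.+1 ->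
  ecoef (i + l.+2) i (s :: x :: t) =
  iP' i s * gq G i s * (P' i s (p i.+1 x - 1) * ecoef (i.+1 + l.+1) i.+1 (x :: t)).
Proof.
move=> si rsT; have [hp hD h1] := commutant_q si rsT (or_introl erefl).
have hR k : (i.+1 <= k < i.+1 + l.+1)%N -> rk i.+1 (x :: t) k \rng k by apply: rk_rng rsT.
have xi : x \rng i.+1 by rewrite -(rk0 i.+1 x t); apply: hR; lia.
rewrite /ecoef.
have -> : ((i + l.+2).-1 - i = l.+1)%N by lia.
have -> : (i + l.+2 - i = l.+2)%N by lia.
have -> : ((i.+1 + l.+1).-1 - i.+1 = l)%N by lia.
have -> : (i.+1 + l.+1 - i.+1 = l.+1)%N by lia.
have rkE k : (i < k)%N -> rk i (s :: x :: t) k = rk i.+1 (x :: t) k by apply: rk_cons.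
have eR (F : nat -> nat -> B) : \prod_(k <- iota i l.+2) F k (rk i (s :: x :: t) k) =
    F i s * \prod_(k <- iota i.+1 l.+1) F k (rk i.+1 (x :: t) k).
  rewrite -[iota i l.+2]/(i :: iota i.+1 l.+1) big_cons rk0; congr (_ * _).
  by apply: eq_big_seq => k; rewrite mem_iota => kl; rewrite rkE //; lia.
rewrite !eR -[iota i l.+1]/(i :: iota i.+1 l) big_cons rk0 (rkE i.+1) // rk0.
set R := rk i.+1 (x :: t).
set N := \prod_(k <- iota i.+1 l) P' k (R k) (p k.+1 (R k.+1) - 1).
rewrite (eq_big_seq (fun k => P' k (R k) (p k.+1 (R k.+1) - 1))) -/N; last first.
  by move=> k; rewrite mem_iota => kl; rewrite !rkE //; lia.
set D := \prod_(k <- iota i.+1 l.+1) iP' k (R k).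
set E := \prod_(k <- iota i.+1 l.+1) gq G k (R k).
have pR k : (i.+1 <= k < i.+1 + l.+1)%N -> pcomm (p k (R k) - 1).
  by move=> kl; apply: commutantB (pcomm_p _) pcomm1; apply: hR.
have qR k : (i.+1 <= k < i.+1 + l.+1)%N -> commutant (eq (gq G i s)) (p k (R k) - 1).
  by move=> kl; apply: commutantB h1; apply: hp; [lia|apply: hR].
have hN : pcomm N.
  by apply: commutant_prod => k; rewrite mem_iota => kl _; apply: pcomm_P'; apply: pR; lia.
have qN : commutant (eq (gq G i s)) N.
  apply: commutant_prod => k; rewrite mem_iota => kl _.
  by apply: commutant_P' => [|u uk _]; [apply: qR; lia|apply: hp => //; lia].
have xR : p i.+1 x - 1 = p i.+1 (R i.+1) - 1 by rewrite /R rk0.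
set X := P' i s _; have hX : pcomm X by rewrite /X xR; apply/pcomm_P'/pR; lia.
have qX : commutant (eq (gq G i s)) X.
  rewrite /X xR; apply: commutant_P' => [|u ui us]; first by apply: qR; lia.
  by move=> _ <-; apply: qp_comm => //; rewrite xpair_eqE eqxx eq_sym.
have qXND := commutantM qX (commutantM qN hD); rewrite -/D in qXND.
have -> : iP' i s * gq G i s * (X * (N * D * E)) = iP' i s * (X * (N * D)) * gq G i s * E.
  by rewrite -[in RHS](mulrA (iP' i s)) -qXND // !mulrA.
have hi := pcomm_iP' si; rewrite !mulrA; congr (_ * _ * _ * _).
by rewrite (pcommC hi hX) -mulrA (pcommC hN hi) mulrA.
Qed.

Lemma sum_ecoef l i s : s \rng i ->
  \sum_(t <- tuples a i.+1 l) - ecoef (i + l.+1) i (s :: t) = chi l i s.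
Proof.
elim: l i s => [|l IH] i s si.
  rewrite chiE big_seq1 /ecoef addn1 /= subnn subSnn /= !big_seq1 big_nil mul1r.
  by rewrite !rk0 mulrN1.
rewrite sum_tuplesS [RHS]chiE SIG_chi mulr_sumr; apply: eq_big_seq => x xi.
rewrite -IH // !mulr_sumr; apply: eq_big_seq => t tl.
rewrite ecoef_cons ?mulrN //; apply/allpairsPdep.
by exists x, t.
Qed.

End Algebra.

(** * Laurent expansions *)

Definition map_gens (A B : Type) (f : A -> B) (G : gens A) : gens B :=
  Gens (fun i s => f (gp G i s)) (fun i s => f (gq G i s)) (fun i s => f (gqi G i s))
    (fun i s t m => f (ginv G i s t m)).

Section MapGens.
Variables (A B : nzRingType) (f : {rmorphism A -> B}) (r : nat) (G : gens A).
Local Notation G' := (map_gens f G).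

Lemma map_rels : rels r G -> rels r G'.
Proof.
case=> h1 h2 h3 h4 h5; split=> [i s j t si tj|i s j t si tj|i s si|i s j t si tj|i s t m si ti st] /=.
- by rewrite -!rmorphM h1.
- by have [e1 e2 e3] := h2 _ _ _ _ si tj; rewrite -!rmorphM e1 e2 e3.
- by have [e1 e2] := h3 _ _ si; rewrite -!rmorphM e1 e2 rmorph1.
- have [e1 e2] := h4 _ _ _ _ si tj; rewrite -!rmorphM -!rmorphB e1 e2.
  by rewrite !rmorphM rmorphN rmorph_nat.
- have [e1 e2] := h5 _ _ _ m si ti st.
  by rewrite -(rmorph_int f) -rmorphB -rmorphD -!rmorphM e1 e2 rmorph1.
Qed.

Lemma map_Pev j x : f (Pev r G j x) = Pev r G' j (f x).
Proof. by rewrite rmorph_prod; apply: eq_bigr => s _; rewrite rmorphB. Qed.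

Lemma map_Pev' j t x : f (Pev' r G j t x) = Pev' r G' j t (f x).
Proof. by rewrite rmorph_prod; apply: eq_bigr => s _; rewrite rmorphB. Qed.

Lemma map_Pinv' j t : f (Pinv' r G j t) = Pinv' r G' j t.
Proof. by rewrite rmorph_prod. Qed.

Lemma map_fcoef j i rs : f (fcoef r G j i rs) = fcoef r G' j i rs.
Proof.
rewrite /fcoef !rmorphM map_Pev rmorphD rmorph1 !(rmorph_prod f (iota _ _)); congr (_ * _ * _ * _).
  by apply: eq_bigr => k _; rewrite map_Pev' rmorphD rmorph1.
by apply: eq_bigr => k _; rewrite map_Pinv'.
Qed.

Lemma map_ecoef j i rs : f (ecoef r G j i rs) = ecoef r G' j i rs.
Proof.
rewrite /ecoef !rmorphM !(rmorph_prod f (iota _ _)); congr (_ * _ * _).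
  by apply: eq_bigr => k _; rewrite map_Pev' rmorphB rmorph1.
by apply: eq_bigr => k _; rewrite map_Pinv'.
Qed.

End MapGens.

Section Transfer.
Variables (A : nzRingType) (r : nat) (G : gens A).
Hypothesis HG : rels r G.
Local Notation a := (acoef r).
Local Notation G' := (map_gens (@constl A) G).
Local Notation z := (zl A).

Let h0 i s := geoml (gp G i s).
Let h1 i s := geoml (gp G i s + 1).

Lemma geoml_comm (x y : A) : GRing.comm x y -> GRing.comm (constl x) (geoml y).
Proof.
move=> xy; apply: comm_inv (mul_geoml y) (geoml_mul y) _.
apply: commrB; first by rewrite /GRing.comm zl_comm.
by rewrite /GRing.comm -!rmorphM xy.
Qed.

Lemma to_laurent_fterm l i rs : rs \in tuples a i l.+1 ->
  to_laurent (fterm r G (i + l.+1) i rs) =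
  h1 i (rk i rs i) * fcoef r G' (i + l.+1) i rs.
Proof.
move=> rsT; rewrite -map_fcoef /fterm /fcoef !to_laurentM.
rewrite -/(constl _) -/(geoml _) -/(constl _) mulrA.
have iR : rk i rs i \in iota 1 (a i) by apply: rk_rng rsT _; lia.
rewrite (geoml_comm (pcommC HG (pcomm_fnum HG rsT) (pcomm_p1 iR))).
by rewrite -mulrA -rmorphM.
Qed.

Lemma to_laurent_eterm l i rs : rs \in tuples a i l.+1 ->
  to_laurent (eterm r G i (i + l.+1) rs) =
  h0 i (rk i rs i) * Pev r G' i.-1 (gp G' i (rk i rs i) - 1) * - ecoef r G' (i + l.+1) i rs.
Proof.
move=> rsT; rewrite -map_ecoef /eterm /ecoef !to_laurentM.
rewrite -/(constl _) -/(geoml _) -/(constl _) mulrA.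
have iR : rk i rs i \in iota 1 (a i) by apply: rk_rng rsT _; lia.
have c := pcommC HG (commutantN (pcomm_enum HG rsT)) (pcomm_p iR).
rewrite (geoml_comm c).
rewrite /= -(rmorph1 (@constl A)) -rmorphB -map_Pev -mulrA -[RHS]mulrA.
by rewrite -rmorphN -!rmorphM mulrN mulNr !mulrA.
Qed.

Lemma to_laurent_fD l i : to_laurent (fD r G (i + l) i) = fser r G' h1 l i.
Proof.
case: l => [|l]; first by rewrite addn0 /fD eqxx.
rewrite /fD ifF; last by apply/negbTE; lia.
rewrite to_laurent_sum big_map addKn.
rewrite (eq_big_seq _ (@to_laurent_fterm l i)) sum_tuplesS; apply: eq_big_seq => s si.
by rewrite -(sum_fcoef (map_rels (@constl A) HG)) // mulr_sumr; apply: eq_bigr => t _; rewrite rk0.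
Qed.

Lemma to_laurent_eD l i : to_laurent (eD r G i (i + l)) = eser r G' h0 l i.
Proof.
case: l => [|l]; first by rewrite addn0 /eD eqxx.
rewrite /eD ifF; last by apply/negbTE; lia.
rewrite to_laurent_sum big_map addKn.
rewrite (eq_big_seq _ (@to_laurent_eterm l i)) sum_tuplesS; apply: eq_big_seq => s si.
by rewrite -(sum_ecoef (map_rels (@constl A) HG)) // mulr_sumr; apply: eq_bigr => t _; rewrite rk0.
Qed.

Lemma to_laurent_gD i :
  to_laurent (gD r G i) = Pev r G' i z * \prod_(s <- iota 1 (a i.-1)) h1 i.-1 s.
Proof.
rewrite /gD to_laurentM !to_laurent_prod !big_map; congr (_ * _).
by apply: eq_bigr => s _; rewrite llinE.
Qed.

Lemma to_laurent_TD al be : to_laurent (TD r G al be) =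
  \sum_(i <- iota 1 (minn al be))
     to_laurent (fD r G al i) * (to_laurent (gD r G i) * to_laurent (eD r G i be)).
Proof.
by rewrite /TD to_laurent_sum big_map; apply: eq_bigr => i _; rewrite !to_laurentM.
Qed.

Definition polynomial (x : laurent A) := forall m : int, m < 0 -> coefl x m = 0.

Lemma polynomial_const c : polynomial (constl c).
Proof. by move=> m m0; rewrite coefl_const lt_eqF. Qed.

Lemma polynomialM x y : polynomial x -> polynomial y -> polynomial (x * y).
Proof.
move=> hx hy m m0; have [d dP] := coefl_bound x; have [e eP] := coefl_bound y.
have [d0 [d0p [d1 d1p]]] : exists d0, 0 <= d0 /\ (exists e0, 0 <= e0 /\
   ((forall m, d0 < m -> coefl x m = 0) /\ (forall m, e0 < m -> coefl y m = 0))).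
  exists `|d|; split => //; exists `|e|; split=> //; split=> j hj.
    by apply: dP; lia.
  by apply: eP; lia.
have [d1_0 [xb yb]] := d1p.
have [k mE] : exists k : nat, m = d0 + d1 - k%:Z by exists `|(d0 + d1 - m)%R|%N; lia.
rewrite mE coefl_mul_le // big1 // => i _; have ik := ltn_ord i.
have [id|id] := ltP (d0 - i%:Z) 0; first by rewrite hx ?mul0r.
by rewrite hy ?mulr0 //; lia.
Qed.

Lemma polynomial_TD al be m : (0 < al <= 2 * r)%N -> (0 < be <= 2 * r)%N -> m < 0 ->
  lcoef (TD r G al be) m = 0.
Proof.
move=> ha hb; rewrite -[lcoef _ _]/(coefl (to_laurent (TD r G al be)) m); move: m.
rewrite -/(polynomial _) to_laurent_TD.
pose l := (al - minn al be)%N; pose k := (be - minn al be)%N.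
rewrite (eq_big_seq (fun i => fser r G' h1 (minn al be + l - i) i *
    (Pev r G' i z * \prod_(s <- iota 1 (a i.-1)) h1 i.-1 s *
     eser r G' h0 (minn al be + k - i) i))).
  apply: (@T_regular _ r G' (map_rels (@constl A) HG) z h0 h1 polynomial).
  - by move=> x; rewrite zl_comm.
  - by move=> i s _; split; [apply: mul_geoml|apply: geoml_mul].
  - move=> i s _; rewrite /= -(rmorph1 (@constl A)) -rmorphD.
    by split; [apply: mul_geoml|apply: geoml_mul].
  - exact: polynomial_const.
  - by move=> x y hx hy m m0; rewrite coeflB hx // hy // subr0.
  - exact: polynomialM.
  - by move=> m m0; rewrite coefl_zl; case: eqVneq m0 => // ->.
  - by move=> *; apply: polynomial_const.
  - by move=> *; apply: polynomial_const.
  - by move=> *; apply: polynomial_const.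
  - by move=> *; apply: polynomial_const.
  - lia.
  - lia.
  - rewrite /l /k; lia.
move=> i; rewrite mem_iota => hi.
have al_i : al = (i + (minn al be + l - i))%N by rewrite /l; lia.
have be_i : be = (i + (minn al be + k - i))%N by rewrite /k; lia.
by rewrite {1}al_i {2}be_i to_laurent_fD to_laurent_eD to_laurent_gD.
Qed.

End Transfer.

(** * Degrees *)

Section Degree.
Variable A : nzRingType.
Implicit Types (x y : laurent A) (d e : int).

Definition deg_le d x := forall m : int, d < m -> coefl x m = 0.

Lemma deg_leW d e x : d <= e -> deg_le d x -> deg_le e x.
Proof. by move=> de dx m em; apply: dx; apply: le_lt_trans em. Qed.

Lemma deg_leM d e x y : deg_le d x -> deg_le e y -> deg_le (d + e) (x * y).
Proof. by move=> dx ey m; apply: coefl_mul_gt dx ey. Qed.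

Lemma coefl_leadM d e x y : deg_le d x -> deg_le e y ->
  coefl (x * y) (d + e) = coefl x d * coefl y e.
Proof.
move=> dx ey; have := coefl_mul_le 0 dx ey.
by rewrite big_ord1 !subr0 => <-.
Qed.

Lemma deg_le_sum d (I : Type) (l : seq I) (F : I -> laurent A) :
  (forall i, deg_le d (F i)) -> deg_le d (\sum_(i <- l) F i).
Proof. by move=> dF m dm; rewrite coefl_sum big1 // => i _; apply: dF. Qed.

Lemma deg_const c : deg_le 0 (constl c : laurent A).
Proof. by move=> m m0; rewrite coefl_const gt_eqF. Qed.

Definition lead1 d x := deg_le d x /\ coefl x d = 1.

Lemma lead1_1 : lead1 0 (1 : laurent A).
Proof. by split; [exact: deg_const|rewrite coefl_const]. Qed.

Lemma lead1M d e x y : lead1 d x -> lead1 e y -> lead1 (d + e) (x * y).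
Proof.
by case=> dx x1 [ey y1]; split; [exact: deg_leM|rewrite coefl_leadM // x1 y1 mulr1].
Qed.

Lemma lead1_prod d (F : nat -> laurent A) k n : (forall s, lead1 d (F s)) ->
  lead1 (d *+ n) (\prod_(s <- iota k n) F s).
Proof.
move=> h; elim: n k => [|n IH] k; first by rewrite big_nil; exact: lead1_1.
by rewrite big_cons mulrS; apply: lead1M.
Qed.

Lemma lead1_geom (c : A) : lead1 (-1) (geoml c).
Proof.
split=> [m hm|]; last by rewrite coefl_geom subrr.
by rewrite coefl_geom; case E: (-1 - m)%R => [k|k] //; lia.
Qed.

Lemma lead1_llin (c : A) : lead1 1 (to_laurent (llin c)).
Proof.
split=> [m hm|]; last by [].
by rewrite /= lcoef_gt.
Qed.

Variables (r : nat) (G : gens A).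
Local Notation F al i := (to_laurent (fD r G al i)).
Local Notation E i be := (to_laurent (eD r G i be)).
Local Notation g i := (to_laurent (gD r G i)).
Local Notation a := (acoef r).

Lemma lead1_gD i : lead1 ((a i)%:Z - (a i.-1)%:Z) (g i).
Proof.
rewrite /gD to_laurentM !to_laurent_prod !big_map; apply: lead1M.
  by have := @lead1_prod 1 (fun s => to_laurent (llin (gp G i s))) 1 (a i); rewrite natz; apply=> s; apply: lead1_llin.
have := @lead1_prod (-1) (fun s => geoml (gp G i.-1 s + 1)) 1 (a i.-1).
by rewrite mulNrn natz; apply=> s; apply: lead1_geom.
Qed.

Lemma deg_term (c c' x : A) (geo : lser A) : geo = lgeom x ->
  deg_le (-1) (to_laurent (lmul (lconst c) (lmul geo (lconst c')))).
Proof.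
move=> ->; rewrite !to_laurentM; apply: (@deg_leM 0 (-1)); first exact: deg_const.
by apply: (@deg_leM (-1) 0); [have [] := lead1_geom x|exact: deg_const].
Qed.

Lemma deg_fD al i : i != al -> deg_le (-1) (F al i).
Proof.
move=> ia; rewrite /fD (negPf ia) to_laurent_sum big_map; apply: deg_le_sum => rs.
exact: deg_term.
Qed.

Lemma deg_eD i be : i != be -> deg_le (-1) (E i be).
Proof.
move=> ib; rewrite /eD (negPf ib) to_laurent_sum big_map; apply: deg_le_sum => rs.
exact: deg_term.
Qed.

Lemma fDii i : F i i = 1. Proof. by rewrite /fD eqxx. Qed.
Lemma eDii i : E i i = 1. Proof. by rewrite /eD eqxx. Qed.

Lemma lead1_gD_lo i : (0 < i <= r)%N -> lead1 1 (g i).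
Proof. by move=> ir; have := lead1_gD i; congr (lead1 _ _); rewrite /acoef; lia. Qed.

Lemma lead1_gD_hi i : (r < i <= 2 * r)%N -> lead1 (-1) (g i).
Proof. by move=> ir; have := lead1_gD i; congr (lead1 _ _); rewrite /acoef; lia. Qed.

Lemma deg_fD0 al i : deg_le 0 (F al i).
Proof.
have [->|ia] := eqVneq i al; first by rewrite fDii; case: lead1_1.
exact: deg_leW (deg_fD ia).
Qed.

Lemma deg_eD0 i be : deg_le 0 (E i be).
Proof.
have [->|ia] := eqVneq i be; first by rewrite eDii; case: lead1_1.
exact: deg_leW (deg_eD ia).
Qed.

Lemma TD_K al be : (r < al <= 2 * r)%N -> (1 <= be <= r)%N ->
  deg_le 0 (to_laurent (TD r G al be)) /\
  lcoef (TD r G al be) 0 = coefl (F al be) (-1).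
Proof.
move=> ha hb; have hi i : i \in iota 1 (minn al be) -> (0 < i <= be)%N /\ i != al.
  by rewrite mem_iota; lia.
have dg i : (0 < i <= be)%N -> deg_le 1 (g i) by move=> ib; case: (@lead1_gD_lo i) => //; lia.
rewrite -[lcoef _ _]/(coefl (to_laurent (TD r G al be)) 0) to_laurent_TD; split.
  move=> m m0; rewrite coefl_sum big_seq big1 // => i /hi[ib ia].
  by apply: (deg_leM (deg_fD ia) (deg_leM (dg _ ib) (deg_eD0 i be))).
have be_in : be \in iota 1 (minn al be) by rewrite mem_iota; lia.
rewrite coefl_sum (bigD1_seq be) ?iota_uniq // eDii mulr1.
have be_al : be != al by lia.
have [dgb g1] : lead1 1 (g be) by apply: lead1_gD_lo; lia.
rewrite (coefl_leadM (deg_fD be_al) dgb : coefl _ 0 = _) g1 mulr1 big_seq_cond big1 ?[LHS]addr0 //.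
move=> i /andP[/hi[ib ia] ibe].
exact: (deg_leM (deg_fD ia) (deg_leM (dg _ ib) (deg_eD ibe))).
Qed.

Lemma TD_Kbar al be : (1 <= al <= r)%N -> (r < be <= 2 * r)%N ->
  deg_le 0 (to_laurent (TD r G al be)) /\
  lcoef (TD r G al be) 0 = coefl (E al be) (-1).
Proof.
move=> ha hb; have hi i : i \in iota 1 (minn al be) -> (0 < i <= al)%N /\ i != be.
  by rewrite mem_iota; lia.
have dg i : (0 < i <= al)%N -> deg_le 1 (g i) by move=> ib; case: (@lead1_gD_lo i) => //; lia.
rewrite -[lcoef _ _]/(coefl (to_laurent (TD r G al be)) 0) to_laurent_TD; split.
  move=> m m0; rewrite coefl_sum big_seq big1 // => i /hi[ia ib].
  by apply: (deg_leM (deg_fD0 al i) (deg_leM (dg _ ia) (deg_eD ib))).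
have al_in : al \in iota 1 (minn al be) by rewrite mem_iota; lia.
rewrite coefl_sum (bigD1_seq al) ?iota_uniq // fDii mul1r.
have al_be : al != be by lia.
have [dga g1] : lead1 1 (g al) by apply: lead1_gD_lo; lia.
rewrite (coefl_leadM dga (deg_eD al_be) : coefl _ 0 = _) g1 mul1r big_seq_cond big1 ?[LHS]addr0 //.
move=> i /andP[/hi[ia ib] ial].
exact: (deg_leM (deg_fD ial) (deg_leM (dg _ ia) (deg_eD ib))).
Qed.

Lemma TD_corner (x y : nat) : (1 <= x <= r)%N -> (1 <= y <= r)%N ->
  lcoef (TD r G (r + x) (r + y)) (-1) =
  \sum_(c <- iota 1 r) coefl (F (r + x) c) (-1) * coefl (E c (r + y)) (-1) + (x == y)%:R.
Proof.
move=> hx hy; rewrite -[lcoef _ _]/(coefl (to_laurent (TD r G (r + x) (r + y))) (-1)).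
rewrite to_laurent_TD coefl_sum -addn_minr iotaD big_cat; congr (_ + _).
  apply: eq_big_seq => i; rewrite mem_iota => hi.
  have [ix iy] : i != (r + x)%N /\ i != (r + y)%N by lia.
  have [dg g1] : lead1 1 (g i) by apply: lead1_gD_lo; lia.
  rewrite (coefl_leadM (deg_fD ix) (deg_leM dg (deg_eD iy)) : coefl _ (-1) = _).
  by rewrite (coefl_leadM dg (deg_eD iy)) g1 mul1r.
have small i : i \in iota (1 + r) (minn x y) -> (i != r + x)%N || (i != r + y)%N ->
    coefl (F (r + x) i * (g i * E i (r + y))) (-1) = 0.
  rewrite mem_iota => hi ixy; have [dg _] : lead1 (-1) (g i) by apply: lead1_gD_hi; lia.
  case/orP: ixy => [ix|iy].
    exact: (deg_leM (deg_fD ix) (deg_leM dg (deg_eD0 i (r + y)))).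
  exact: (deg_leM (deg_fD0 (r + x) i) (deg_leM dg (deg_eD iy))).
have [xy|xy] := eqVneq x y; last first.
  by rewrite big_seq big1 // => i il; apply: small => //; lia.
have xin : (r + x)%N \in iota (1 + r) (minn x y) by rewrite mem_iota; lia.
rewrite -xy in xin *; rewrite (bigD1_seq (r + x)%N) ?iota_uniq //.
rewrite fDii eDii mul1r mulr1 big_seq_cond big1 ?[LHS]addr0 => [|i /andP[il ix]].
  by have [] : lead1 (-1) (g (r + x)) by apply: lead1_gD_hi; lia.
by rewrite {2}xy; apply: small; rewrite ?ix // -xy.
Qed.

End Degree.

Theorem theorem2p38 (A : nzRingType) (r : nat) (G : gens A) :
  (1 <= r)%N -> rels r G ->
  [/\ (* K (lower-left block) is independent of z *)
      (forall al be : nat, (r < al <= 2 * r)%N -> (1 <= be <= r)%N ->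
         forall m : int, m != 0 -> lcoef (TD r G al be) m = 0),
      (* Kbar (upper-right block) is independent of z *)
      (forall al be : nat, (1 <= al <= r)%N -> (r < be <= 2 * r)%N ->
         forall m : int, m != 0 -> lcoef (TD r G al be) m = 0) &
      (* K * Kbar = - I_r *)
      (forall x y : nat, (1 <= x <= r)%N -> (1 <= y <= r)%N ->
         \sum_(c <- iota 1 r)
            lcoef (TD r G (r + x) c) 0 * lcoef (TD r G c (r + y)) 0
         = - (x == y)%:R)].
Proof.
move=> r_gt0 HG; split=> [al be ha hb m|al be ha hb m|x y hx hy].
- case: ltgtP => // hm _; first by apply: polynomial_TD => //; lia.
  by have [h _] := TD_K G ha hb; apply: h.
- case: ltgtP => // hm _; first by apply: polynomial_TD => //; lia.
  by have [h _] := TD_Kbar G ha hb; apply: h.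
apply/eqP; rewrite -addr_eq0; apply/eqP.
rewrite -[RHS](@polynomial_TD A r G HG (r + x) (r + y) (-1)) //; try lia.
rewrite TD_corner //; congr (_ + _); apply: eq_big_seq => c; rewrite mem_iota => hc.
have [_ ->] := @TD_K A r G (r + x) c ltac:(lia) ltac:(lia).
by have [_ ->] := @TD_Kbar A r G c (r + y) ltac:(lia) ltac:(lia).
Qed.
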